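(* Let $\alpha',\alpha\ge 1$ be integers, let $\alpha_o'\in\{1,\dots,\alpha'\}$ and $\alpha_o\in\{1,\dots,\alpha\}$, and let $p'=p\in[0,1]$. Let $H(\bar\omega)=T'(\omega')\circ T(\omega)$ be the random horocyclic product of the percolation subtrees $T'(\omega')=T_{\alpha_o',\alpha'}(\omega')$ and $T(\omega)=T_{\alpha_o,\alpha}(\omega)$ (minimal numbers of offspring $\alpha_o',\alpha_o$, maximal numbers of offspring $\alpha',\alpha$, retention parameters $p',p$), and let $C_{\bar o}(\bar\omega)$ be the connected component of $H(\bar\omega)$ containing the root $\bar o=\langle o',o\rangle$. Suppose that $$\alpha_o'+p'(\alpha'-\alpha_o')=\alpha_o+p(\alpha-\alpha_o).$$ Then, $\bar\mu$-almost surely, the restriction $H(\bar\omega)|C_{\bar o}(\bar\omega)$ has anchored isoperimetric constant equal to zero, i.e. it is $\bar\mu$-almost surely strongly amenable.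
   Context: **Trees with a fixed end.** Let $\mathcal T'$ and $\mathcal T$ be homogeneous trees of degree $\alpha'+1$ and $\alpha+1$, with fixed roots $o',o$ and fixed ends $\gamma',\gamma$. (An end is an equivalence class of rays, i.e. infinite paths without repeated vertices; two rays in a tree are equivalent if their traces differ by only finitely many vertices.) For a vertex $x$ of $\mathcal T$, let $c$ be the confluent of $x$ and $o$ with respect to $\gamma$, i.e. the first common vertex of the rays from $x$ to $\gamma$ and from $o$ to $\gamma$. The Busemann function (level) is $\mathbf h(x)=d(x,c)-d(c,o)$. The function $\mathbf h'$ on $\mathcal T'$ is defined analogously. Each vertex $x$ of $\mathcal T$ has one neighbour (parent) at level $\mathbf h(x)-1$ and $\alpha$ neighbours (children) at level $\mathbf h(x)+1$; similarly in $\mathcal T'$ with $\alpha'$ children. **Horocyclic product.** The Diestel-Leader graph $G=\mathcal T'\circ\mathcal T=DL_{\alpha',\alpha}$ has vertex set $V=\{\langle k',k\rangle\in V(\mathcal T')\times V(\mathcal T): \mathbf h'(k')=-\mathbf h(k)\}$. Its edges are the pairs $\{\langle k',k\rangle,\langle l',l\rangle\}\subset V$ with $k'\sim l'$ in $\mathcal T'$ and $k\sim l$ in $\mathcal T$. The root is $\bar o=\langle o',o\rangle$. **Percolation.** At each vertex of $\mathcal T$, number the $\alpha$ edges to its children by $1,\dots,\alpha$. Edges with number at most $\alpha_o$ are unmarked, the others are marked. Do the same in $\mathcal T'$ with $\alpha',\alpha_o'$. Under $\mu$ (for $\omega\in\Omega=2^{E(\mathcal T)}$), all unmarked edges of $\mathcal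 T$ are open, and the marked edges are open independently with probability $p$ each. Under $\mu'$ (for $\omega'\in\Omega'=2^{E(\mathcal T')}$) the same holds in $\mathcal T'$ with $p'$. Let $\bar\mu=\mu'\otimes\mu$ on $\Omega'\times\Omega$, and $\bar\omega=\langle\omega',\omega\rangle$. $T'(\omega')$ and $T(\omega)$ denote the random subgraphs of open edges. $H(\bar\omega)=T'(\omega')\circ T(\omega)$ is the subgraph of $G$ with vertex set $V$ in which an edge $\{\langle k',k\rangle,\langle l',l\rangle\}$ of $G$ is retained if and only if both $\{k',l'\}$ and $\{k,l\}$ are open. $H|C$ is the subgraph of $H$ induced by $C$. **Strong amenability.** For a finite subgraph $F$ of a graph $\Gamma$ with vertex set $V_F$, put $I_\Gamma(F)=|\partial_\Gamma V_F|/|V_F|$, where $\partial_\Gamma V_F$ is the set of vertices of $\Gamma$ outside $V_F$ having a neighbour (in $\Gamma$) in $V_F$. The anchored isoperimetric constant of $\Gamma$ with root $\bar o$ is $$I=\liminf_{n\to\infty}\ \inf\{I_\Gamma(F): F\text{ a connected subgraph of }\Gamma\text{ with } n \text{ vertices, containing }\bar o\}.$$ By convention, a finite graph has constant $0$. $\Gamma$ is strongly amenable if $I=0$. *)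

(* Defs.v *)
From HB Require Import structures.
From mathcomp Require Import all_boot all_order all_algebra finmap.
From mathcomp Require Import all_classical all_reals all_analysis.

Set Implicit Arguments.
Unset Strict Implicit.
Unset Printing Implicit Defensive.

Import Order.TTheory GRing.Theory Num.Theory.

Local Open Scope classical_set_scope.

Local Open Scope ring_scope.

Record graph (V : choiceType) := Graph {
  vset : set V ;
  adj : rel V ;
  adj_sym : symmetric adj ;
  adj_irr : irreflexive adj ;
  adj_vset : forall x y, adj x y -> vset x }.

Section Graphs.
Variable V : choiceType.
Implicit Types (G F : graph V) (x y : V) (A C : set V).

Definition linked G x y := exists2 s : seq V, path (adj G) x s & last x s = y.

Definition connected_graph G :=
  forall x y, vset G x -> vset G y -> linked G x y.

Definition acyclic G := forall s : seq V, ucycle (adj G) s -> (size s <= 2)%N.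

Definition is_tree G := connected_graph G /\ acyclic G.

Definition homogeneous_tree (d : nat) G :=
  is_tree G /\ forall x, vset G x -> ([set y | adj G x y] #= `I_d)%card.

Definition component G x : set V := [set y | vset G y /\ linked G x y].

Definition induced_adj G C : rel V :=
  fun x y => [&& adj G x y, x \in C & y \in C].

Lemma induced_adj_sym G C : symmetric (induced_adj G C).
Proof.
by move=> x y; rewrite /induced_adj adj_sym; congr andb; rewrite andbC.
Qed.

Lemma induced_adj_irr G C : irreflexive (induced_adj G C).
Proof. by move=> x; rewrite /induced_adj adj_irr. Qed.

Lemma induced_adj_vset G C x y :
  induced_adj G C x y -> (vset G `&` C) x.
Proof. by case/and3P=> /adj_vset Gx /set_mem Cx _; split. Qed.

Definition induced_subgraph G C : graph V :=
  Graph (@induced_adj_sym G C) (@induced_adj_irr G C) (@induced_adj_vset G C).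

Definition subgraph F G :=
  vset F `<=` vset G /\ forall x y, adj F x y -> adj G x y.

(** The junk value is 0 when [x] and [y] are not linked. *)
Definition gdist G x y : nat :=
  xget 0%N [set n |
    (exists s, [/\ path (adj G) x s, last x s = y & size s = n]) /\
    (forall s, path (adj G) x s -> last x s = y -> (n <= size s)%N)].

Definition vboundary G A : set V :=
  [set y | [/\ vset G y, ~ A y & exists2 x, A x & adj G x y]].

(** Only meaningful when [vset F] is finite and nonempty; [counting] takes the
    value [+oo] on infinite sets. *)
Definition iso_ratio (R : realType) G F : \bar R :=
  ((counting (vboundary G (vset F)) : \bar R)
    * ((#|` fset_set (vset F)|%:R)^-1)%:E)%E.

Definition anchored_constant (R : realType) G (o : V) : \bar R :=
  if `[< finite_set (vset G) >] then 0%E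
  else limn_einf (fun n : nat => ereal_inf
         [set iso_ratio R G F | F in
           [set F | [/\ subgraph F G, connected_graph F,
                        (vset F #= `I_n)%card & vset F o]]]).

Definition strongly_amenable (R : realType) G (o : V) :=
  anchored_constant R G o = 0%E.

Definition ray G (r : nat -> V) :=
  injective r /\ forall n, adj G (r n) (r n.+1).

Definition ray_equiv (r s : nat -> V) :=
  finite_set ((range r `\` range s) `|` (range s `\` range r)).

Definition is_end G (g : set (nat -> V)) :=
  exists2 r, ray G r & g = [set s | ray G s /\ ray_equiv r s].

(** The first vertex, along the ray from [x] in the end [g], that lies on the
    ray from [y] in [g]; in a tree there is exactly one ray of [g] from each
    vertex, and the notion is symmetric in [x] and [y]. *)
Definition is_confluent (g : set (nat -> V)) x y (c : V) :=
  exists r s, [/\ g r /\ r 0%N = x, g s /\ s 0%N = y &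
    exists i, [/\ r i = c, range s c & forall j, (j < i)%N -> ~ range s (r j)]].

Definition confluent (g : set (nat -> V)) x y : V :=
  xget y [set c | is_confluent g x y c].

Definition busemann G (g : set (nat -> V)) (o : V) x : int :=
  let c := confluent g x o in (gdist G x c)%:Z - (gdist G c o)%:Z.

Definition child G (h : V -> int) x y := adj G x y /\ h y = h x + 1.

Definition edge G :=
  {e : {fset V} | `[< exists x y, adj G x y /\ e = [fset x; y]%fset >]}.

Definition edge_to_children G (h : V -> int) x : set (edge G) :=
  [set e | exists2 y, child G h x y & val e = [fset x; y]%fset].

Definition child_numbering G (h : V -> int) (n : nat) (num : edge G -> nat) :=
  forall x, vset G x ->
    set_bij (edge_to_children h x) [set i | (1 <= i <= n)%N] num.

Definition marked G (num : edge G -> nat) (n0 : nat) : pred (edge G) :=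
  fun e => (n0 < num e)%N.

Definition edge_open G (e : edge G) : set (edge G -> bool) := [set w | w e].

(** The product space 2^E(G), with the sigma-algebra generated by the
    coordinates. *)
Definition config G := g_sigma_algebraType (range (@edge_open G)).

Definition open_adj G (w : edge G -> bool) : rel V :=
  fun x y => if insub [fset x; y]%fset is Some e then w e else false.

Lemma open_adj_adj G w x y : @open_adj G w x y -> adj G x y.
Proof.
rewrite /open_adj; case: insubP => // e /asboolP[a [b [Gab exy]]] _ _.
have: a \in [fset x; y]%fset by rewrite exy !inE eqxx.
have: b \in [fset x; y]%fset by rewrite exy !inE eqxx orbT.
have neq : a != b by apply: contraTneq Gab => ->; rewrite adj_irr.
rewrite !inE => /orP[]/eqP bE /orP[]/eqP aE; move: Gab neq.
- by rewrite aE bE eqxx.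
- by rewrite aE bE adj_sym.
- by rewrite aE bE.
- by rewrite aE bE eqxx.
Qed.

Lemma open_adj_sym G w : symmetric (@open_adj G w).
Proof. by move=> x y; rewrite /open_adj fsetUC. Qed.

Lemma open_adj_irr G w : irreflexive (@open_adj G w).
Proof.
by move=> x; apply/negP => /open_adj_adj; rewrite adj_irr.
Qed.

Lemma open_adj_vset G w x y : @open_adj G w x y -> vset G x.
Proof. by move=> /open_adj_adj /adj_vset. Qed.

Definition open_graph G (w : edge G -> bool) : graph V :=
  Graph (@open_adj_sym G w) (@open_adj_irr G w) (@open_adj_vset G w).

End Graphs.

Section Percolation.
Context {R : realType}.
Local Open Scope ereal_scope.

Definition mutually_independent d (T : measurableType d)
    (mu : probability T R) (I : choiceType) (D : set I) (A : I -> set T) :=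
  forall J : {fset I}, [set` J] `<=` D ->
    mu (\bigcap_(i in [set` J]) A i) = \prod_(i <- J) mu (A i).

(** These conditions determine [mu] when [G] has countably many edges. *)
Definition percolation_measure (V : choiceType) (G : graph V)
    (mk : pred (edge G)) (p : R) (mu : probability (config G) R) :=
  [/\ {ae mu, forall w : config G, forall e, ~~ mk e -> edge_open e w},
      forall e, mk e -> mu (edge_open e) = p%:E &
      mutually_independent mu [set e | mk e] (@edge_open V G)].

End Percolation.

Section Horocyclic.
Variables (V' V : choiceType) (h' : V' -> int) (h : V -> int).
Variables (G' : graph V') (G : graph V).

Definition horo_vset : set (V' * V) :=
  [set k | [/\ vset G' k.1, vset G k.2 & h' k.1 = - h k.2]].

Definition horo_adj : rel (V' * V) := fun k l =>
  [&& k \in horo_vset, l \in horo_vset, adj G' k.1 l.1 & adj G k.2 l.2].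

Lemma horo_adj_sym : symmetric horo_adj.
Proof.
move=> k l; rewrite /horo_adj (adj_sym _ k.1) (adj_sym _ k.2).
by rewrite andbCA.
Qed.

Lemma horo_adj_irr : irreflexive horo_adj.
Proof. by move=> k; rewrite /horo_adj adj_irr /= !andbF. Qed.

Lemma horo_adj_vset k l : horo_adj k l -> horo_vset k.
Proof. by case/andP => /set_mem. Qed.

Definition horo : graph (V' * V)%type :=
  Graph horo_adj_sym horo_adj_irr horo_adj_vset.

End Horocyclic.

(* Main.v *)
Require Import Defs.
From HB Require Import structures.
From mathcomp Require Import all_boot all_order all_algebra finmap.
From mathcomp Require Import all_classical all_reals all_analysis.
From mathcomp Require Import measurable_realfun zify lra.

Set Implicit Arguments.
Unset Strict Implicit.
Unset Printing Implicit Defensive.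

Import Order.TTheory GRing.Theory Num.Theory.
Import numFieldNormedType.Exports.

Local Open Scope classical_set_scope.
Local Open Scope ring_scope.

(** The failure probability must be made arbitrarily small, which a second moment estimate of [Z_j]
    would not give. The lower bound comes instead from the identity E(u^Z_n) = f^n(u), with f the
    offspring generating function. For u = 1 - m^-(n-k), a small value of u^Z_n forces Z_n to be at
    least of order m^(n-k). Since some child is always kept, f(t) carries a factor t, so 0 attracts:
    n-k iterations bring u away from 1, uniformly in n, and k more, with k depending only on the
    allowed error, push the value below it. The loss m^k is a constant. The upper bound on Z_n is
    Markov's inequality.

    A union bound over all generations would be too costly. The defects of the generations are
    averaged over j <= n, and one Markov inequality controls this average together with Z_n / m^n.
    An average defect of 1/4 in each tree still leaves half of the sum over j.

    Equality of the means enters through m^(n-j) m^j = m^n: each typical layer of the tetrahedron is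
    then as large, up to constants, as its whole boundary. *)

(* Truncating the two percolation trees at an apex x' of T' and an apex x of T,
   n levels apart, gives a tetrahedron in the horocyclic product H: if Z'_j and
   Z_j count the open descendants of x' and x in generation j, it has
   sum_j Z'_(n-j) Z_j vertices, while its boundary, which sits above the two
   apexes, has at most a' Z'_n + a Z_n.  Both (Z'_j) and (Z_j) are
   Galton-Watson processes with the same mean m and without extinction, so that
   with high probability Z_j and Z'_j are comparable to m^j for most j <= n, and
   the isoperimetric ratio is then O(1/n).

   Such tetrahedra lie in the component of the root as soon as the rays from o'
   and o to their apexes are open: if one of the two rays to the fixed ends is
   entirely open, move its apex along it and keep the other apex at the root.
   If neither is, the component is contained in one tetrahedron and is finite.
   Since only the small probability of atypical generation sizes enters, a union
   bound replaces conditioning on the open ray, and infinitely many good n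
   suffice for the liminf. *)

(** * Paths and rays *)

Section Trees.
Variables (V : choiceType) (G : graph V).
Hypothesis Gac : acyclic G.

(* Otherwise the two paths, up to their first meeting point, close up into a
   cycle of length at least 3. *)
Lemma simple_path_unique x s t :
  path (adj G) x s -> uniq (x :: s) -> path (adj G) x t -> uniq (x :: t) ->
  last x s = last x t -> s = t.
Proof.
elim: s x t => [|y s IH] x [|z t] //.
- move=> _ _ _ /= /andP[/negP xt _] xl; case: xt.
  by have := mem_last z t; rewrite -xl.
- move=> _ /= /andP[/negP xt _] _ _ xl; case: xt.
  by have := mem_last y s; rewrite xl.
have [<-{z} /=|yz] := eqVneq y z.
  move=> /andP[xy ys] /andP[_ us] /andP[_ yt] /andP[_ ut] st.
  by congr cons; apply: IH st.
move=> ps us pt ut st; exfalso.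
have hs : has (mem (z :: t)) (y :: s).
  apply/hasP; exists (last y s); first exact: mem_last.
  by have := mem_last z t; rewrite -[last z t]st.
have hd1 : y = head x (y :: s) by [].
have hd2 : z = head x (z :: t) by [].
move: ps us pt ut hs hd1 hd2; move: (y :: s) (z :: t) => S U ps us pt ut hs.
case/split_find: hs ps us => v s1 s2 /= vU nU ps us.
case/splitPr: {2 3 4}U / vU (erefl U) pt ut nU => t1 t2 UE pt ut nU yE zE.
have cyc : ucycle (adj G) (x :: rcons s1 v ++ rev t1).
  apply/andP; split.
    rewrite /= rcons_cat cat_path last_rcons.
    move: ps; rewrite cat_path => /andP[-> _] /=.
    have : path (adj G) x (rcons t1 v).
      by move: pt; rewrite -cat_rcons cat_path => /andP[].
    move=> ptv; have := rev_path (adj G) x (rcons t1 v).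
    rewrite last_rcons belast_rcons rev_cons => ->.
    by rewrite (eq_path (e' := adj G)) // => b c; rewrite /= adj_sym.
  move: us ut; rewrite /= mem_cat negb_or cat_uniq => /andP[/andP[xs _]].
  move=> /and3P[us1 _ _] /andP[xt]; rewrite cat_uniq => /and3P[ut1 vt1 _].
  rewrite mem_cat negb_or xs mem_rev.
  move: xt; rewrite mem_cat negb_or => /andP[-> _] /=.
  rewrite cat_uniq us1 rev_uniq ut1 andbT /=.
  apply/hasPn => b; rewrite mem_rev => bt1 /=; rewrite mem_rcons inE.
  apply/norP; split.
    apply/eqP => bv; move: vt1 => /=; rewrite -bv => /norP[].
    by rewrite bt1.
  by apply: contra nU => bs1; apply/hasP; exists b; rewrite //= UE mem_cat bt1.
(* A cycle of at most two vertices leaves [s1] and [t1] empty, so both paths step from [x] to [v],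
   against [yz]. *)
have /= := Gac cyc; rewrite size_cat size_rcons size_rev addSn !ltnS.
rewrite leqn0 addn_eq0 => /andP[/nilP s10 /nilP t10].
by move: yE zE yz; rewrite UE s10 t10 /= => -> ->; rewrite eqxx.
Qed.

Lemma simple_subpath x s : path (adj G) x s ->
  exists t, [/\ path (adj G) x t, uniq (x :: t), last x t = last x s &
                (size t <= size s)%N].
Proof.
move=> ps; case: (shortenP ps) => t pt ut st; exists t; split=> //.
by apply: uniq_leq_size => //; case/andP: ut.
Qed.

(** Any competing path shortens to a simple one, and the simple path is unique. *)
Lemma gdist_path x s : path (adj G) x s -> uniq (x :: s) ->
  gdist G x (last x s) = size s.
Proof.
move=> ps us; apply: xget_subset1; last first.
  move=> m n [[sm [pm lm <-]] mm] [[sn [pn ln <-]] mn].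
  by apply/eqP; rewrite eqn_leq mm // mn.
split; first by exists s.
move=> t pt lt; have [t' [pt' ut' lt' st']] := simple_subpath pt.
by rewrite (simple_path_unique ps us pt' ut') // lt' lt.
Qed.

End Trees.

Section Gdist.
Variables (V : choiceType) (G : graph V).

Lemma reverse_path x s : path (adj G) x s ->
  exists t, [/\ path (adj G) (last x s) t, last (last x s) t = x &
                size t = size s].
Proof.
move=> ps; exists (rev (belast x s)); split.
- by rewrite rev_path (eq_path (e' := adj G)) // => b c; rewrite /= adj_sym.
- by case: s {ps} => //= y s; rewrite rev_cons last_rcons.
- by rewrite size_rev size_belast.
Qed.

Lemma gdist_sym x y : gdist G x y = gdist G y x.
Proof.
congr xget; apply/funext => n; apply/propext.
suff sw z t : (exists s, [/\ path (adj G) z s, last z s = t & size s = n]) /\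
    (forall s, path (adj G) z s -> last z s = t -> (n <= size s)%N) ->
    (exists s, [/\ path (adj G) t s, last t s = z & size s = n]) /\
    (forall s, path (adj G) t s -> last t s = z -> (n <= size s)%N).
  by split; apply: sw.
case=> [[s [ps ls <-]] mn]; split.
  by have [u [pu lu su]] := reverse_path ps; exists u; rewrite -ls.
move=> u pu lu; have [u' [pu' lu' <-]] := reverse_path pu.
by apply: mn; rewrite -?lu.
Qed.

Lemma linked_refl x : linked G x x.
Proof. by exists [::]. Qed.

Lemma linked_trans y x z : linked G x y -> linked G y z -> linked G x z.
Proof.
move=> [s ps ls] [t pt lt]; exists (s ++ t); rewrite ?last_cat ?ls//.
by rewrite cat_path ps ls.
Qed.

Lemma linked_sym x y : linked G x y -> linked G y x.
Proof. by case=> s /reverse_path[t [pt lt _]] <-; exists t. Qed.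

Lemma adj_linked x y : adj G x y -> linked G x y.
Proof. by move=> xy; exists [:: y] => //=; rewrite xy. Qed.

End Gdist.

(** * Rays of a fixed end and the Busemann function *)

Section Rays.
Variables (V : choiceType) (G : graph V) (g : set (nat -> V)).
Hypotheses (Gtree : is_tree G) (gend : is_end G g).

Let initial_segment (r : nat -> V) n := mkseq (fun i => r i.+1) n.

Let segment_last r n : last (r 0%N) (initial_segment r n) = r n.
Proof.
by case: n => [|n] //; rewrite /initial_segment mkseqS last_rcons.
Qed.

Let segment_path r n : ray G r -> path (adj G) (r 0%N) (initial_segment r n).
Proof.
case=> _ radj; elim: n => // n IH.
rewrite /initial_segment mkseqS -cats1 cat_path.
by rewrite IH segment_last /= radj.
Qed.

Let segment_uniq r n : ray G r -> uniq (r 0%N :: initial_segment r n).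
Proof.
case=> rinj _; have -> : r 0%N :: initial_segment r n = mkseq r n.+1.
  by rewrite /initial_segment /mkseq /= (iotaDl 1 0) -map_comp.
by rewrite mkseq_uniq.
Qed.

Lemma gdist_ray r n : ray G r -> gdist G (r 0%N) (r n) = n.
Proof.
move=> rr; rewrite -[in r n](segment_last r) gdist_path ?size_mkseq //.
- exact: Gtree.2.
- exact: segment_path.
- exact: segment_uniq.
Qed.

Lemma ray_eq_upto r s i j : ray G r -> ray G s -> r 0%N = s 0%N -> r i = s j ->
  i = j /\ forall k, (k <= i)%N -> r k = s k.
Proof.
move=> rr rs r0 rij.
have := @simple_path_unique _ _ Gtree.2 (r 0%N) (initial_segment r i)
  (initial_segment s j) (segment_path i rr) (segment_uniq i rr).
rewrite {1 2 4}r0 !segment_last => /(_ (segment_path j rs) (segment_uniq j rs) rij) E.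
have ij : i = j by have := congr1 size E; rewrite !size_mkseq.
split=> // -[|k] ki //.
have := congr1 (fun s => nth (r 0%N) s k) E.
by rewrite !nth_mkseq // -ij.
Qed.

Lemma end_ray r : g r -> ray G r.
Proof. by case: gend => r0 _ -> []. Qed.

Lemma end_ray_equiv r s : g r -> g s -> ray_equiv r s.
Proof.
case: gend => r0 _ -> [_ er] [_ es].
have := conj er es; rewrite -finite_setU; apply: sub_finite_set => x [[rx nsx]|[sx nrx]].
  by have [r0x|nr0x] := pselect (range r0 x); [right; left|left; right].
by have [r0x|nr0x] := pselect (range r0 x); [left; left|right; right].
Qed.

Lemma end_ray_closed r s : g r -> ray G s -> ray_equiv r s -> g s.
Proof.
case: gend => r0 _ -> [_ er] rs es; split=> //.
have := conj er es; rewrite -finite_setU; apply: sub_finite_set => x [[rx nsx]|[sx nrx]].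
  by have [r0x|nr0x] := pselect (range r x); [right; left|left; left].
by have [r0x|nr0x] := pselect (range r x); [left; right|right; right].
Qed.

Lemma end_rays_meet r s n : g r -> g s -> exists2 i, (n <= i)%N & range s (r i).
Proof.
move=> gr gs; apply: contrapT => nex.
have rinj : injective r by case: (end_ray gr).
have : finite_set (range (fun i => r (i + n)%N)).
  apply: sub_finite_set (end_ray_equiv gr gs) => _ [i _ <-]; left.
  split; first by exists (i + n)%N.
  by move=> sri; apply: nex; exists (i + n)%N => //; exact: leq_addl.
case/finite_range_cst_subsequence => x [A infA Ax]; apply: infA.
have [[k Ak]|nA] := pselect (exists k, A k); last first.
  by apply: sub_finite_set (finite_set0 _) => k Ak; apply: nA; exists k.
apply: sub_finite_set (finite_set1 k) => l /Ax; move/Ax: Ak => <-.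
by move=> /rinj /addIn.
Qed.

Lemma end_ray_unique r s : g r -> g s -> r 0%N = s 0%N -> r = s.
Proof.
move=> gr gs r0; apply/funext => n.
have [i ni [j _ sj]] := end_rays_meet n gr gs.
have [_] := ray_eq_upto (end_ray gr) (end_ray gs) r0 (esym sj); exact.
Qed.

Lemma end_ray_shift r n : g r -> g (fun i => r (n + i)%N).
Proof.
move=> gr; have [rinj radj] := end_ray gr.
apply: (end_ray_closed gr).
  by split=> [i j /rinj /addnI //|i]; rewrite addnS.
apply: (@sub_finite_set _ _ (r @` `I_n)); last exact: finite_image.
move=> x [[[i _ <-] nx]|[[i _ <-] []]]; last by exists (n + i)%N.
exists i => //=; rewrite ltnNge; apply/negP => ni; apply: nx.
by exists (i - n)%N => //; rewrite subnKC.
Qed.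

Lemma end_ray_cons r x : g r -> adj G x (r 0%N) -> ~ range r x ->
  g (fun i => if i is j.+1 then r j else x).
Proof.
move=> gr xr nx; have [rinj radj] := end_ray gr.
apply: (end_ray_closed gr).
  split; last by case.
  by case=> [|i] [|j] // => [E|E|/rinj ->//]; case: nx; [exists j|exists i].
apply: (@sub_finite_set _ _ [set x]); last exact: finite_set1.
move=> y [[[i _ <-] nr]|[[[|i] _ <-] nr] //].
by case: nr; exists i.+1.
Qed.

(** Walk back from a ray of the end to [x]: at each step the new vertex either lies on the current
    ray, which is then shortened, or is put in front of it. *)
Lemma exists_end_ray x : vset G x -> exists2 r, g r & r 0%N = x.
Proof.
move=> Gx; have [r0 rr0 gE] := gend.
have gr0 : g r0.
  by rewrite gE; split=> //; apply: sub_finite_set (finite_set0 _); rewrite !setDv setU0.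
have Gr0 : vset G (r0 0%N) by case: rr0 => _ /(_ 0%N) /adj_vset.
have [s ps ls] := Gtree.1 _ _ Gx Gr0.
elim: s x ps ls {Gx} => /= [|y s IH] x; first by move=> _ ->; exists r0.
move=> /andP[xy ys] /(IH _ ys)[r gr ry].
have [[i _ rx]|nrx] := pselect (range r x).
  by exists (fun j => r (i + j)%N); [exact: end_ray_shift|rewrite addn0].
by exists (fun i => if i is j.+1 then r j else x) => //;
  apply: end_ray_cons; rewrite ?ry.
Qed.

Definition end_ray_from (x : V) : nat -> V :=
  @xget (nat -> V) (fun=> x) [set r | g r /\ r 0%N = x].

Lemma end_ray_fromP x : vset G x -> g (end_ray_from x) /\ end_ray_from x 0%N = x.
Proof.
move=> /exists_end_ray[r gr r0]; rewrite /end_ray_from.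
by case: xgetP => [_ ->//|/(_ r)]; case.
Qed.

Lemma end_ray_fromE r : g r -> end_ray_from (r 0%N) = r.
Proof.
move=> gr; have Gr : vset G (r 0%N) by case: (end_ray gr) => _ /(_ 0%N) /adj_vset.
have [gx x0] := end_ray_fromP Gr; exact: end_ray_unique.
Qed.

Definition parent x := end_ray_from x 1%N.

Lemma adj_parent x : vset G x -> adj G x (parent x).
Proof.
move=> /end_ray_fromP[gx x0]; rewrite -[in adj G x]x0.
by case: (end_ray gx).
Qed.

(** If [y] lies on the ray from [x], uniqueness of simple paths places it at index 1. If not,
    prepending [y] to that ray yields the ray from [y]. *)
Lemma adj_parentP x y : adj G x y -> y = parent x \/ x = parent y.
Proof.
move=> xy; have Gx := adj_vset xy.
have [gx x0] := end_ray_fromP Gx; set r := end_ray_from x in gx x0.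
have [[i _ ry]|nry] := pselect (range r y).
  left; rewrite /parent -/r.
  have i0 : i != 0%N by apply: contraTneq xy => i0; rewrite -ry i0 x0 adj_irr.
  have [rinj _] := end_ray gx.
  have E := @simple_path_unique _ _ Gtree.2 (r 0%N) (initial_segment r i)
    [:: y] (segment_path i (end_ray gx)) (segment_uniq i (end_ray gx)).
  have : size (initial_segment r i) = 1%N.
    rewrite E ?segment_last //= x0 ?xy // inE andbT.
    by apply: contraTneq xy => ->; rewrite adj_irr.
  by rewrite size_mkseq => i1; rewrite -ry i1.
right; have := @end_ray_fromE (fun i => if i is j.+1 then r j else y).
rewrite /parent => -> //; apply: end_ray_cons => //.
by rewrite x0 adj_sym.
Qed.

Variable o : V.
Hypothesis Go : vset G o.

(** Uniqueness of rays from a vertex makes the first hit [r i] the only confluent, at distance [i]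
    from [r 0] and [k] from [o]. *)
Let busemann_ray r i k : g r -> (forall j, (j < i)%N -> ~ range (end_ray_from o) (r j)) ->
  r i = end_ray_from o k -> busemann G g o (r 0%N) = i%:Z - k%:Z.
Proof.
have [go oo] := end_ray_fromP Go.
move=> gr nr rik.
have cE : confluent g (r 0%N) o = r i.
  apply: xget_subset1.
    exists r, (end_ray_from o); split=> //; exists i; split=> //.
    by rewrite rik; exists k.
  have uniqc c : is_confluent g (r 0%N) o c -> c = r i.
    move=> [r' [s [[gr' r'0] [gs s0] [j [<- rj nj]]]]].
    have sE : s = end_ray_from o by apply: end_ray_unique; rewrite ?oo.
    have r'E : r' = r by exact: end_ray_unique.
    rewrite sE r'E in rj nj *; case: (ltngtP j i) => [ji|ij|-> //].
      by case: (nr _ ji).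
    by case: (nj _ ij); rewrite rik; exists k.
  by move=> c d /uniqc -> /uniqc ->.
rewrite /busemann cE gdist_ray; last exact: end_ray.
have := gdist_ray k (end_ray go); rewrite oo => ok.
by rewrite rik gdist_sym ok.
Qed.

Lemma busemann_parent x : vset G x ->
  busemann G g o (parent x) = busemann G g o x - 1.
Proof.
move=> Gx; have [gx x0] := end_ray_fromP Gx.
have [go oo] := end_ray_fromP Go.
rewrite /parent -[in RHS]x0; move: (end_ray_from x) gx {x0} => r gr.
have gr1 : g (fun i => r (1 + i)%N) by exact: end_ray_shift.
have exi : exists i, `[< range (end_ray_from o) (r i) >].
  by have [i _ ri] := end_rays_meet 0 gr go; exists i; apply/asboolP.
(* If the first hit has index 0, the vertex is on the ray from [o] and its parent is its own
   confluent, one step further from [o]. Otherwise the confluent is unchanged and one step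
   nearer. *)
case: (ex_minnP exi) => -[|i] /asboolP[k _ rk] mini.
  rewrite (@busemann_ray r 0 k) //.
  have rE : r = (fun i => end_ray_from o (k + i)%N).
    apply: end_ray_unique => //; first exact: end_ray_shift.
    by rewrite addn0.
  rewrite (@busemann_ray (fun i => r (1 + i)%N) 0 k.+1) //; last first.
    by rewrite rE /= addnA addn1 addn0.
  lia.
have nr j : (j < i.+1)%N -> ~ range (end_ray_from o) (r j).
  by move=> ji /asboolP /mini; rewrite leqNgt ji.
rewrite (@busemann_ray r i.+1 k) // (@busemann_ray (fun i => r (1 + i)%N) i k) //.
  lia.
by move=> j ji; apply: nr.
Qed.

Lemma busemann_root : busemann G g o o = 0.
Proof.
have [go oo] := end_ray_fromP Go.
by rewrite -[X in busemann _ _ _ X]oo (@busemann_ray _ 0 0).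
Qed.

End Rays.

(** * Levels and open descendants *)

Lemma uniq_flatten_map (I J : eqType) (f : I -> seq J) s : uniq s ->
  (forall i, i \in s -> uniq (f i)) ->
  (forall i j x, i \in s -> j \in s -> x \in f i -> x \in f j -> i = j) ->
  uniq (flatten (map f s)).
Proof.
elim: s => //= i s IH /andP[nis us] uf disj.
rewrite cat_uniq uf ?mem_head // IH //; last 2 first.
- by move=> j js; apply: uf; rewrite inE js orbT.
- by move=> j k x js ks; apply: disj; rewrite inE ?js ?ks orbT.
rewrite andbT /=; apply/hasPn => x /flatten_mapP[j js xj].
apply/negP => xi; move: nis.
by rewrite (disj i j x) ?mem_head ?inE ?js ?orbT.
Qed.

Lemma size_flatten_const (I J : eqType) (f : I -> seq J) m s :
  (forall i, i \in s -> size (f i) = m) -> size (flatten (map f s)) = (m * size s)%N.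
Proof.
elim: s => [|i s IH] sf /=; first by rewrite muln0.
rewrite size_cat sf ?mem_head // IH ?mulnS // => j js.
by apply: sf; rewrite inE js orbT.
Qed.

(** [par] is the parent, [ch] lists the children, and the edge between [x] and
    [par x] is indexed by its lower end [x]. *)
Record horotree (V : choiceType) (T : graph V) (h : V -> int)
    (par : V -> V) (ch : V -> seq V) (ed : V -> edge T) : Prop := Horotree {
  ht_adj_par : forall x, vset T x -> adj T x (par x) ;
  ht_level_par : forall x, vset T x -> h (par x) = h x - 1 ;
  ht_adjP : forall x y, adj T x y -> y = par x \/ x = par y ;
  ht_uniq : forall x, vset T x -> uniq (ch x) ;
  ht_mem : forall x y, vset T x -> y \in ch x <-> vset T y /\ par y = x ;
  ht_edge : forall x, vset T x -> val (ed x) = [fset x; par x]%fset }.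

Lemma eq_fset2l (K : choiceType) (x y z : K) :
  [fset x; y]%fset = [fset x; z]%fset -> y = z.
Proof.
move=> E; have : y \in [fset x; z]%fset by rewrite -E !inE eqxx orbT.
have : z \in [fset x; y]%fset by rewrite E !inE eqxx orbT.
rewrite !inE => /orP[/eqP zx|/eqP -> //] /orP[/eqP yx|/eqP -> //].
by rewrite yx zx.
Qed.

(** Inverting the numbering lists the children of [x] as [f x 1], ..., [f x a]; in this order the
    unmarked edges are those of the first [a0] children. *)
Lemma exists_horotree (V : choiceType) (T : graph V) (o : V)
    (g : set (nat -> V)) (a a0 : nat) (num : edge T -> nat) :
  is_tree T -> is_end T g -> vset T o ->
  child_numbering (busemann T g o) a num -> (a0 <= a)%N ->
  exists par ch ed, horotree (busemann T g o) par ch ed /\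
    forall x, vset T x -> size (ch x) = a /\
      count (fun y => ~~ marked num a0 (ed y)) (ch x) = a0.
Proof.
move=> Ttree Tend To numP a0a; set h := busemann T g o in numP *.
have adj_edge x y : adj T x y -> exists e : edge T, val e = [fset x; y]%fset.
  move=> xy; have xyP : `[< exists x' y', adj T x' y' /\
      [fset x; y]%fset = [fset x'; y']%fset >] by apply/asboolP; exists x, y.
  by exists (Sub [fset x; y]%fset xyP : edge T); rewrite SubK.
have [e0 _] := adj_edge _ _ (adj_parent Ttree Tend To).
pose par := parent g.
have parP x y : vset T x -> child T h x y <-> vset T y /\ par y = x.
  move=> Tx; split=> [[xy hy]|[Ty <-]].
    have Ty : vset T y by move: xy; rewrite adj_sym => /adj_vset.
    split=> //; case: (adj_parentP Ttree Tend xy) => // yE; exfalso.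
    by have := busemann_parent Ttree Tend To Tx; rewrite -yE -/h; lia.
  split; first by rewrite adj_sym; exact: adj_parent.
  by have := busemann_parent Ttree Tend To Ty; rewrite -/h -/par; lia.
pose ed z := xget e0 [set e : edge T | val e = [fset z; par z]%fset].
have edP z : vset T z -> val (ed z) = [fset z; par z]%fset.
  move=> Tz; rewrite /ed; case: xgetP => [e -> //|nex].
  have [e eE] := adj_edge _ _ (adj_parent Ttree Tend Tz).
  by have := nex e; rewrite /= eE.
pose f x i := xget x [set y | child T h x y /\ num (ed y) = i].
have edch x y : vset T x -> child T h x y -> edge_to_children h x (ed y).
  move=> Tx /[dup] cxy /(parP _ _ Tx)[Ty pyx]; exists y => //.
  by rewrite edP // pyx fsetUC.
have fP x i : vset T x -> (1 <= i <= a)%N ->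
    child T h x (f x i) /\ num (ed (f x i)) = i.
  move=> Tx ia; rewrite /f; case: xgetP => [y -> //|nex].
  have [_ _ /(_ i ia)[e [y cxy eE] ei]] := numP _ Tx.
  have [Ty pyx] := (parP _ _ Tx).1 cxy.
  have edy : ed y = e by apply: val_inj; rewrite edP // pyx fsetUC.
  by case: (nex y); split; rewrite ?edy.
have Ef x y : vset T x -> child T h x y -> f x (num (ed y)) = y.
  move=> Tx cxy; have [num1 numinj _] := numP _ Tx.
  have [cf nf] := fP _ _ Tx (num1 _ (edch _ _ Tx cxy)).
  have := numinj _ _ (mem_set (edch _ _ Tx cf)) (mem_set (edch _ _ Tx cxy)) nf.
  have [Tf pf] := (parP _ _ Tx).1 cf; have [Ty py] := (parP _ _ Tx).1 cxy.
  move/(congr1 val); rewrite !edP // pf py fsetUC [in RHS]fsetUC.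
  exact: eq_fset2l.
have inI i : i \in iota 1 a = (1 <= i <= a)%N by rewrite mem_iota add1n ltnS.
exists par, (fun x => map (f x) (iota 1 a)), ed; split; last first.
  move=> x Tx; split; first by rewrite size_map size_iota.
  rewrite count_map (@eq_in_count _ _ (fun i => (i <= a0)%N)).
    rewrite -[in iota 1 a](subnKC a0a) iotaD count_cat.
    have /[!all_count] /eqP -> : all (fun i => (i <= a0)%N) (iota 1 a0).
      by apply/allP => i; rewrite mem_iota add1n ltnS => /andP[].
    rewrite size_iota (@eq_in_count _ _ pred0) ?count_pred0 ?addn0 //.
    by move=> i; rewrite mem_iota add1n /= => /andP[+ _]; rewrite ltnNge => /negbTE.
  move=> i; rewrite inI => ia /=; have [_ nE] := fP _ _ Tx ia.
  by rewrite /marked nE -leqNgt.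
split=> //.
- exact: adj_parent.
- exact: busemann_parent.
- exact: adj_parentP.
- move=> x Tx; rewrite map_inj_in_uniq ?iota_uniq // => i j.
  rewrite !inI => ia ja fij.
  by have [_ <-] := fP _ _ Tx ia; rewrite fij; have [_ ->] := fP _ _ Tx ja.
- move=> x y Tx; rewrite -parP //; split.
    by case/mapP => i; rewrite inI => ia ->; have [] := fP _ _ Tx ia.
  move=> cxy; apply/mapP; exists (num (ed y)); last by rewrite Ef.
  by rewrite inI; have [+ _ _] := numP _ Tx; apply; exact: edch.
Qed.

Section HorotreeTheory.
Variables (V : choiceType) (T : graph V) (h : V -> int).
Variables (par : V -> V) (ch : V -> seq V) (ed : V -> edge T).
Hypothesis HT : horotree h par ch ed.

Lemma vset_par x : vset T x -> vset T (par x).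
Proof. by move=> /(ht_adj_par HT); rewrite adj_sym => /adj_vset. Qed.

Lemma vset_iter_par i x : vset T x -> vset T (iter i par x).
Proof. by move=> Tx; elim: i => //= i; exact: vset_par. Qed.

Lemma level_iter_par i x : vset T x -> h (iter i par x) = h x - i%:Z.
Proof.
move=> Tx; elim: i => [|i IH] /=; first by rewrite subr0.
by rewrite (ht_level_par HT) ?IH; [lia|exact: vset_iter_par].
Qed.

(** Two distinct vertices with the same upward edge would be parents of each other, which the levels
    forbid. Events on edges may thus be indexed by vertices. *)
Lemma up_edge_inj x y : vset T x -> vset T y -> ed x = ed y -> x = y.
Proof.
move=> Tx Ty /(congr1 val); rewrite !(ht_edge HT) // => E.
have : x \in [fset y; par y]%fset by rewrite -E !inE eqxx.
have : y \in [fset x; par x]%fset by rewrite E !inE eqxx.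
rewrite !inE => /orP[/eqP -> //|/eqP yE] /orP[/eqP //|/eqP xE].
have := ht_level_par HT Tx; have := ht_level_par HT Ty.
by rewrite -xE -yE; lia.
Qed.

Lemma open_up_edge (w : edge T -> bool) x : vset T x ->
  open_adj w x (par x) = w (ed x).
Proof. by move=> Tx; rewrite /open_adj -(ht_edge HT Tx) valK. Qed.

Lemma open_adjP (w : edge T -> bool) x y : open_adj w x y ->
  (y = par x /\ w (ed x)) \/ (x = par y /\ w (ed y)).
Proof.
move=> wxy; have xy := open_adj_adj wxy; have Tx := adj_vset xy.
have Ty : vset T y by move: xy; rewrite adj_sym => /adj_vset.
have [yE|xE] := ht_adjP HT xy; [left|right].
  by rewrite -open_up_edge // -yE.
by rewrite -open_up_edge // -xE open_adj_sym.
Qed.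

(** Open descendants in generation [n]. The recursion from the top yields the branching recursion
    for sizes; [mem_desc] gives the view from below through iterated parents. *)
Fixpoint desc (w : edge T -> bool) n x : seq V :=
  if n is m.+1 then flatten [seq desc w m y | y <- ch x & w (ed y)]
  else [:: x].

Lemma mem_desc w n x z : vset T x ->
  z \in desc w n x <-> [/\ vset T z, iter n par z = x &
                          forall i, (i < n)%N -> w (ed (iter i par z))].
Proof.
elim: n x => [|n IH] x Tx /=.
  by rewrite inE; split=> [/eqP ->|[_ ->]].
split.
  case/flatten_mapP => y; rewrite mem_filter => /andP[wy].
  move=> /(ht_mem HT y Tx)[Ty yx] /(IH _ Ty)[Tz zy wz].
  by split=> //=; rewrite ?zy // => i; rewrite ltnS leq_eqVlt => /predU1P[->|/wz//]; rewrite zy.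
case=> Tz zx wz; apply/flatten_mapP; exists (iter n par z).
  rewrite mem_filter wz //=; apply/(ht_mem HT) => //; split=> //.
  exact: vset_iter_par.
apply/IH; first exact: vset_iter_par.
by split=> // i ni; apply: wz; apply: ltnW.
Qed.

Lemma desc_vset w n x z : vset T x -> z \in desc w n x -> vset T z.
Proof. by move=> Tx /(mem_desc _ _ _ Tx)[]. Qed.

Lemma desc_level w n x z : vset T x -> z \in desc w n x -> h z = h x + n%:Z.
Proof.
by move=> Tx /(mem_desc _ _ _ Tx)[Tz <- _]; rewrite level_iter_par //; lia.
Qed.

Lemma desc_uniq w n x : vset T x -> uniq (desc w n x).
Proof.
elim: n x => //= n IH x Tx.
have Tf y : y \in [seq y <- ch x | w (ed y)] -> vset T y.
  by rewrite mem_filter => /andP[_ /(ht_mem HT _ Tx)[]].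
apply: uniq_flatten_map; first exact: filter_uniq (ht_uniq HT Tx).
  by move=> y /Tf; exact: IH.
move=> y z v /Tf Ty /Tf Tz /(mem_desc _ _ _ Ty)[_ <- _].
by move=> /(mem_desc _ _ _ Tz)[].
Qed.

End HorotreeTheory.

(** * Iterated generating functions *)

Section OffspringGeneratingFunction.
Variables (R : realType) (c : seq R).
Hypothesis c01 : forall x, x \in c -> 0 <= x <= 1.

(** This is 1 - x <= 1 / (1 + x) in each factor, together with prod (1 + x) >= 1 + sum x. It is the
    source of all upper bounds on [pgf]. *)
Lemma prod_1sub_sum_le1 (s : seq R) : (forall x, x \in s -> 0 <= x <= 1) ->
  0 <= \prod_(x <- s) (1 - x) /\ 0 <= \sum_(x <- s) x /\
  (\prod_(x <- s) (1 - x)) * (1 + \sum_(x <- s) x) <= 1.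
Proof.
elim: s => [|x s IH] s01; first by rewrite !big_nil; split; [|split]; lra.
rewrite !big_cons; have [|P0 [S0 PS]] := IH.
  by move=> y ys; apply: s01; rewrite inE ys orbT.
have /andP[x0 x1] := s01 x (mem_head _ _).
move: (\prod_(_ <- s) _) (\sum_(_ <- s) _) P0 S0 PS => P S P0 S0 PS.
split; first by rewrite mulr_ge0 //; lra.
split; first lra.
have P1 : P <= 1 by nra.
nra.
Qed.

(** Generating function of a sum of independent Bernoulli variables with the parameters listed in
    [c]. *)
Definition pgf (t : R) : R := \prod_(x <- c) (1 - x * (1 - t)).

Let m := \sum_(x <- c) x.

Let scaled e : 0 <= e <= 1 -> forall x, x \in [seq x * e | x <- c] -> 0 <= x <= 1.
Proof. by move=> e01 _ /mapP[x /c01 x01 ->]; apply/andP; split; nra. Qed.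

(** The comparison function 1 / (1 + m (1 - t)) is the generating function of the geometric law of
    mean [m], whose iterates are explicit. *)
Lemma pgf_lower t : 0 <= t <= 1 -> pgf t * (1 + m * (1 - t)) <= 1.
Proof.
move=> t01; have [|_ [_]] := @prod_1sub_sum_le1 [seq x * (1 - t) | x <- c].
  by apply: scaled; lra.
by rewrite !big_map -mulr_suml.
Qed.

Lemma pgf01 t : 0 <= t <= 1 -> 0 <= pgf t <= 1.
Proof.
move=> t01; have [|P0 [S0]] := @prod_1sub_sum_le1 [seq x * (1 - t) | x <- c].
  by apply: scaled; lra.
rewrite !big_map -/(pgf t) in P0 S0 *.
move: (\sum_(_ <- c) _) S0 => S S0 PS.
by apply/andP; split => //; nra.
Qed.

Lemma iter_pgf01 n t : 0 <= t <= 1 -> 0 <= iter n pgf t <= 1.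
Proof. by move=> t01; elim: n => //= n; exact: pgf01. Qed.

(** The parameter 1 contributes the factor [t]; the others, of sum [m - 1], contribute at most 1 /
    (1 + (m - 1) (1 - t)), and 1 - t >= [eta]. *)
Lemma pgf_contract t eta : 1 \in c -> 0 <= t -> 0 <= eta -> t <= 1 - eta ->
  pgf t * (1 + (m - 1) * eta) <= t.
Proof.
move=> c1 t0 eta0 teta; rewrite /pgf /m !(perm_big _ (perm_to_rem c1)) !big_cons /=.
have [|P0 [S0]] := @prod_1sub_sum_le1 [seq x * (1 - t) | x <- rem 1 c].
  move=> _ /mapP[x /mem_rem /c01 x01 ->]; nra.
have S'0 : 0 <= \sum_(x <- rem 1 c) x.
  by rewrite big_seq; apply: sumr_ge0 => x /mem_rem /c01 /andP[].
rewrite !big_map -mulr_suml in P0 S0 *.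
move: (\prod_(_ <- _) _) (\sum_(_ <- _) _) P0 S0 S'0 => P S P0 S0 S'0 PS.
have : t * P * (S * eta) <= t * P * (S * (1 - t)).
  by apply: ler_wpM2l; [exact: mulr_ge0|apply: ler_wpM2l => //; lra].
have : t * (P * (1 + S * (1 - t))) <= t by rewrite ler_piMr.
lra.
Qed.

(* The inverse of [1 - pgf^i t] grows at most like the affine recursion
   [A_(i+1) = 1 + A_i / m], whose fixed point is [1 / (1 - m^-1)]. *)
Lemma iter_pgf_lower t i : 1 < m -> 0 <= t < 1 ->
  1 <= (1 - iter i pgf t) * (m^-1 ^+ i / (1 - t) + (1 - m^-1)^-1).
Proof.
move=> m1 t01; have m0 : m != 0 by lra.
set D := (1 - m^-1)^-1.
have r01 : 0 < m^-1 < 1 by rewrite invr_gt0 invf_lt1; lra.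
have D0 : 0 < D by rewrite invr_gt0; lra.
have DE : 1 + m^-1 * D = D.
  have : D * (1 - m^-1) = 1 by rewrite mulVf //; lra.
  lra.
elim: i => [|i IH] /=.
  rewrite expr0 mul1r; have : (1 - t)^-1 * (1 - t) = 1 by rewrite mulVf //; lra.
  have : 0 <= (1 - t) * D by apply: mulr_ge0; lra.
  lra.
have := @iter_pgf01 i t; have := @pgf_lower (iter i pgf t).
have := @pgf01 (iter i pgf t).
have -> : m^-1 ^+ i.+1 / (1 - t) + D = 1 + m^-1 * (m^-1 ^+ i / (1 - t) + D).
  by rewrite exprS; lra.
move: (iter i pgf t) IH => s IH f01 fl s01.
have {}s01 : 0 <= s <= 1 by apply: s01; lra.
have {}fl := fl s01; have {}f01 := f01 s01.
move: (m^-1 ^+ i / (1 - t) + D) IH => A IH.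
have A0 : 0 <= m^-1 * A.
  apply: mulr_ge0; first lra.
  by rewrite leNgt; apply/negP => A0; have : (1 - s) * A <= 0; [nra|lra].
have E1 : m * (m^-1 * A) = A by rewrite mulrA mulfV // mul1r.
move: (m^-1 * A) A0 E1 => B B0 AE; rewrite -AE in IH.
move: (pgf s) f01 fl => f f01 fl.
have s1 : 0 <= m * (1 - s) by apply: mulr_ge0; lra.
have {}s1 : 0 < 1 + m * (1 - s) by lra.
rewrite -(ler_pM2r s1) mul1r.
have : (1 - f) * (1 + m * (1 - s)) >= m * (1 - s) by lra.
move=> fm; have : m * (1 - s) * (1 + B) <= (1 - f) * (1 + m * (1 - s)) * (1 + B).
  by apply: ler_wpM2r => //; lra.
lra.
Qed.

Lemma iter_pgf_contract n t eta : 1 \in c -> 1 <= m -> 0 <= t -> 0 <= eta ->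
  t <= 1 - eta -> iter n pgf t <= (1 + (m - 1) * eta)^-1 ^+ n.
Proof.
move=> c1 m1 t0 eta0 teta.
have q1 : 1 <= 1 + (m - 1) * eta.
  by rewrite lerDl mulr_ge0 //; lra.
have t01 : 0 <= t <= 1 by lra.
suff : iter n pgf t <= (1 + (m - 1) * eta)^-1 ^+ n /\ iter n pgf t <= 1 - eta.
  by case.
elim: n => [|n [IH IH']] /=; first by split => //; rewrite expr0; lra.
have /andP[s0 s1] := iter_pgf01 n t01.
have ctr := pgf_contract c1 s0 eta0 IH'.
have /andP[f0 f1] := pgf01 (iter_pgf01 n t01).
split; last by apply: le_trans IH'; nra.
rewrite exprSr ler_pdivlMr; last lra.
exact: le_trans IH.
Qed.

Lemma bernoulli (x : R) n : 0 <= x <= 1 -> 1 - n%:R * x <= (1 - x) ^+ n.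
Proof.
move=> x01; elim: n => [|n IH]; first by rewrite expr0; lra.
rewrite exprS -natr1.
have n0 : 0 <= n%:R :> R by [].
have : (1 - x) * (1 - n%:R * x) <= (1 - x) * (1 - x) ^+ n.
  by apply: ler_wpM2l => //; lra.
have : 0 <= n%:R * x * x by rewrite !mulr_ge0 //; lra.
lra.
Qed.

(* [iter n pgf u] is the generating function at [u] of the size [Z] of
   generation [n]; the last clause turns it into a lower bound on [Z]. *)
Lemma iter_pgf_small (eps : R) : 1 \in c -> 1 <= m -> 0 < eps ->
  exists delta : R, 0 < delta /\ exists n0, forall n, (n0 <= n)%N ->
  exists u : R, [/\ 0 <= u <= 1, iter n pgf u <= eps &
    forall Z, (0 < Z)%N -> delta * (1 - 2 * u ^+ Z) * m ^+ n <= Z%:R].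
Proof.
move=> c1 m1 eps0; have [m_gt1|m_le1] := ltP 1 m; last first.
  (* For [m] = 1 take [u] = 0, which is a fixed point of [pgf] because of the factor [t]. As 0 ^ Z =
     0 for positive [Z], the last clause reads 1 <= [Z]. *)
  have mE : m = 1 by lra.
  exists 1; split=> //; exists 1%N => -[//|n] _; exists 0; split=> [| |Z Z0].
  - by rewrite lexx ler01.
  - have pgf0 : pgf 0 = 0.
      rewrite /pgf (perm_big _ (perm_to_rem c1)) big_cons subr0 mulr1 /=.
      by rewrite subrr mul0r.
    have -> : iter n.+1 pgf 0 = 0 by elim: n => //= n ->.
    exact: ltW.
  - by rewrite mE expr1n expr0n eqn0Ngt Z0 mulr0 subr0 !mulr1 ler1n.
have m0 : 0 < m by lra.
have r01 : 0 < m^-1 < 1 by rewrite invr_gt0 invf_lt1; lra.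
(* [B] is the bracket of [iter_pgf_lower] at t = 1 - m^-j after [j] steps, so these bring t below 1
   - 1/B for every [j]. From there each step contracts by [q], and [k] of them reach [eps]. The
   remaining [k] generations cost the factor m^k in [delta]. *)
set B := 1 + (1 - m^-1)^-1.
have B1 : 1 <= B by rewrite /B lerDl invr_ge0; lra.
have B01 : 0 < B^-1 <= 1 by rewrite invr_gt0 invf_le1; lra.
set q := (1 + (m - 1) * B^-1)^-1.
have q_gt1 : 1 < 1 + (m - 1) * B^-1 by rewrite ltrDl mulr_gt0; lra.
have q01 : 0 < q < 1 by rewrite invr_gt0 invf_lt1; lra.
have [k qk] : exists k, q ^+ k <= eps.
  have /cvgrPdist_le /(_ _ eps0) [k _ /(_ k (leqnn k))] : q ^+ n @[n --> \oo] --> (0 : R^o).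
    by apply: cvg_expr; rewrite ger0_norm; lra.
  rewrite sub0r normrN ger0_norm; first by exists k.
  by apply: exprn_ge0; lra.
have mk0 : 0 < m ^+ k by exact: exprn_gt0.
exists (2 * m ^+ k)^-1; split; first by rewrite invr_gt0; lra.
exists k.+1 => n kn; set j := (n - k)%N.
have nE : n = (k + j)%N by rewrite subnKC // ltnW.
have j0 : (0 < j)%N by rewrite subn_gt0.
have mj0 : 0 < m ^+ j by exact: exprn_gt0.
have rj : 0 < m^-1 ^+ j < 1.
  rewrite exprn_gt0; last lra.
  by rewrite exprn_ilt1 ?ltW; lra || rewrite -lt0n.
exists (1 - m^-1 ^+ j); split; first lra.
  rewrite nE iterD; apply: le_trans qk; apply: iter_pgf_contract => //.
  - by have /andP[] := @iter_pgf01 j (1 - m^-1 ^+ j) ltac:(lra).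
  - lra.
  - have := @iter_pgf_lower (1 - m^-1 ^+ j) j m_gt1 ltac:(lra).
    rewrite [X in _ / X](_ : _ = m^-1 ^+ j) ?mulfV; last 2 first.
    + by lra.
    + by lra.
    rewrite -/B => h; suff : B^-1 <= 1 - iter j pgf (1 - m^-1 ^+ j) by lra.
    by rewrite -[B^-1]mul1r ler_pdivrMr //; lra.
(* Bernoulli gives u^Z >= 1 - Z m^-j, hence (1 - 2 u^Z) / 2 <= Z m^-j; multiply by m^j. *)
move=> Z Z0; have := @bernoulli (m^-1 ^+ j) Z ltac:(lra).
move: (_ ^+ Z) => v bern.
have -> : (2 * m ^+ k)^-1 * (1 - 2 * v) * m ^+ n = (1 - 2 * v) / 2 * m ^+ j.
  rewrite nE exprD invfM; have := @mulVf _ (m ^+ k) ltac:(lra).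
  move: (m ^+ j) (m ^+ k) (m ^+ k)^-1 => z y x xy.
  have -> : 2^-1 * x * (1 - 2 * v) * (y * z) = (1 - 2 * v) / 2 * z * (x * y) by lra.
  by rewrite xy mulr1.
have Zr : Z%:R * m^-1 ^+ j * m ^+ j = Z%:R.
  by rewrite -mulrA -exprMn mulVf ?expr1n ?mulr1; lra.
rewrite -[leRHS]Zr; apply: ler_wpM2r; first lra.
have : 0 <= Z%:R * m^-1 ^+ j by rewrite mulr_ge0 //; lra.
lra.
Qed.

End OffspringGeneratingFunction.

(** * Polynomials in independent events *)

Section IndependentEvents.
Context d (T : measurableType d) (R : realType).
Variables (mu : probability T R) (I : choiceType) (A : I -> set T) (D : set I).
Variable q : I -> R.
Hypothesis mA : forall i, D i -> measurable (A i).
Hypothesis indep : forall J : {fset I}, [set` J] `<=` D ->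
  mu (\bigcap_(i in [set` J]) A i) = (\prod_(i <- J) q i)%:E.

Definition monomial (J : {fset I}) (w : T) : R := \prod_(i <- J) \1_(A i) w.

Definition polynomial (l : seq (R * {fset I})) (w : T) : R :=
  \sum_(cJ <- l) cJ.1 * monomial cJ.2 w.

(** Restricting to polynomials in finitely many indicators avoids the
    sigma-algebras generated by subfamilies of events. *)
Definition depends (S : set I) (F : T -> R) :=
  S `<=` D /\ exists2 l : seq (R * {fset I}),
    (forall cJ, cJ \in l -> [set` cJ.2] `<=` S) & F = polynomial l.

Definition mean (F : T -> R) : R := (\int[mu]_w F w)%R.

Lemma monomialE J : monomial J = \1_(\bigcap_(i in [set` J]) A i).
Proof.
apply/funext => w; rewrite indicE; have [wA|nwA] := asboolP ((\bigcap_(i in [set` J]) A i) w).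
  rewrite mem_set // /monomial big_seq big1 // => i iJ.
  by rewrite indicE mem_set //; apply: wA.
rewrite memNset //; have [i [iJ nwi]] : exists i, i \in J /\ ~ A i w.
  apply: contrapT => nex; apply: nwA => i iJ; apply: contrapT => nwi.
  by apply: nex; exists i.
by rewrite /monomial (big_fsetD1 i) //= indicE memNset // mul0r.
Qed.

(** Indicators are idempotent, so common factors merge and polynomials are closed under products. *)
Lemma monomialM J K w : monomial J w * monomial K w = monomial (J `|` K)%fset w.
Proof.
rewrite !monomialE !indicE -natrM mulnb -in_setI; congr (_ (_ \in _))%:R.
apply/seteqP; split=> [v [vJ vK] i /=|v vJK].
  by rewrite inE => /orP[/vJ|/vK].
by split=> i iJ; apply: vJK; rewrite /= inE iJ ?orbT.
Qed.

Lemma polynomial_cons cJ l w :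
  polynomial (cJ :: l) w = cJ.1 * monomial cJ.2 w + polynomial l w.
Proof. by rewrite /polynomial big_cons. Qed.

Lemma polynomial_cat l l' w : polynomial (l ++ l') w = polynomial l w + polynomial l' w.
Proof. by rewrite /polynomial big_cat. Qed.

Let mul1 (cJ : R * {fset I}) l := [seq (cJ.1 * dK.1, (cJ.2 `|` dK.2)%fset) | dK <- l].

Let polynomial_mul1 cJ l w :
  polynomial (mul1 cJ l) w = cJ.1 * monomial cJ.2 w * polynomial l w.
Proof.
rewrite /polynomial big_map mulr_sumr; apply: eq_bigr => dK _ /=.
by rewrite -monomialM; lra.
Qed.

Lemma depends_sub S S' F : S `<=` S' -> S' `<=` D -> depends S F -> depends S' F.
Proof.
move=> SS' S'D [_ [l lS ->]]; split=> //; exists l => // cJ /lS lS'.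
exact: subset_trans lS' SS'.
Qed.

Lemma depends_cst (S : set I) c : S `<=` D -> depends S (fun=> c).
Proof.
move=> SD; split=> //; exists [:: (c, fset0)].
  by move=> cJ; rewrite inE => /eqP -> i.
by apply/funext => w; rewrite /polynomial big_seq1 /monomial big_seq_fset0 mulr1.
Qed.

Lemma depends_indic i : D i -> depends [set i] (\1_(A i)).
Proof.
move=> Di; split; first by move=> _ ->.
exists [:: (1, [fset i]%fset)].
  by move=> cJ; rewrite inE => /eqP -> j /=; rewrite inE => /eqP.
by apply/funext => w; rewrite /polynomial big_seq1 /monomial big_seq_fset1 mul1r.
Qed.

Lemma dependsD S F G : depends S F -> depends S G -> depends S (fun w => F w + G w).
Proof.
move=> [SD [l lS ->]] [_ [k kS ->]]; split=> //; exists (l ++ k).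
  by move=> cJ; rewrite mem_cat => /orP[/lS|/kS].
by apply/funext => w; rewrite polynomial_cat.
Qed.

Lemma dependsM S F G : depends S F -> depends S G -> depends S (fun w => F w * G w).
Proof.
move=> [SD [l lS ->]] [_ [k kS ->]]; split=> //.
exists (flatten [seq mul1 cJ k | cJ <- l]).
  move=> cJ /flatten_mapP[e /lS eS /mapP[f /kS fS ->]] i /=.
  by rewrite inE => /orP[/eS|/fS].
apply/funext => w; elim: l {lS} => /= [|cJ l IH].
  by rewrite /polynomial !big_nil mul0r.
by rewrite polynomial_cat polynomial_cons mulrDl IH polynomial_mul1.
Qed.

Let measurable_bigcap (J : {fset I}) : [set` J] `<=` D ->
  measurable (\bigcap_(i in [set` J]) A i).
Proof.
by move=> JD; apply: fin_bigcap_measurable; [exact: finite_fset|move=> i /JD /mA].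
Qed.

Let integrable_monomial (c : R) J : [set` J] `<=` D ->
  mu.-integrable setT (EFin \o (fun w => c * monomial J w)).
Proof.
move=> JD; rewrite monomialE.
have := integrableZl measurableT c (integrable_indic mu (measurable_bigcap JD)).
exact: eq_integrable.
Qed.

Let mean_monomial (c : R) J : [set` J] `<=` D ->
  mean (fun w => c * monomial J w) = c * \prod_(i <- J) q i.
Proof.
move=> JD; rewrite /mean RintegralZl //; last first.
  by have := @integrable_monomial 1 J JD; apply: eq_integrable => // w _ /=; rewrite mul1r.
congr *%R; rewrite monomialE /Rintegral integral_indic //; last first.
  exact: measurable_bigcap.
rewrite setIT; exact: (congr1 fine (indep JD)).
Qed.

Lemma depends_integrable S F : depends S F -> mu.-integrable setT (EFin \o F).
Proof.
move=> [SD [l lS ->]]; elim: l lS => [|cJ l IH] lS.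
  have -> : polynomial [::] = (fun=> 0) by apply/funext => w; rewrite /polynomial big_nil.
  exact: finite_measure_integrable_cst.
have -> : EFin \o polynomial (cJ :: l) =
    (EFin \o (fun w => cJ.1 * monomial cJ.2 w)) \+ (EFin \o polynomial l).
  by apply/funext => w /=; rewrite polynomial_cons.
apply: integrableD => //; last by apply: IH => dK dKl; apply: lS; rewrite inE dKl orbT.
by apply: integrable_monomial; apply: subset_trans SD; apply: lS; exact: mem_head.
Qed.

Lemma mean_cst c : mean (fun=> c) = c.
Proof.
rewrite /mean Rintegral_cst //.
by have /= -> := congr1 fine (probability_setT mu); rewrite mulr1.
Qed.

Lemma meanD S F G : depends S F -> depends S G ->
  mean (fun w => F w + G w) = mean F + mean G.
Proof.
by move=> /depends_integrable iF /depends_integrable iG; rewrite /mean RintegralD.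
Qed.

Lemma meanZ S F c : depends S F -> mean (fun w => c * F w) = c * mean F.
Proof. by move=> /depends_integrable iF; rewrite /mean RintegralZl. Qed.

Let mean_polynomial (l : seq (R * {fset I})) : (forall cJ, cJ \in l -> [set` cJ.2] `<=` D) ->
  mean (polynomial l) = \sum_(cJ <- l) cJ.1 * \prod_(i <- cJ.2) q i.
Proof.
elim: l => [|cJ l IH] lD.
  rewrite big_nil -[RHS](mean_cst 0); congr mean; apply/funext => w.
  by rewrite /polynomial big_nil.
have lD' dK : dK \in l -> [set` dK.2] `<=` D.
  by move=> dKl; apply: lD; rewrite inE dKl orbT.
have cD : [set` cJ.2] `<=` D by apply: lD; exact: mem_head.
rewrite big_cons -IH // -mean_monomial // /mean -RintegralD //.
- by congr Rintegral; apply/funext => w; rewrite polynomial_cons.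
- exact: integrable_monomial.
- by apply: (@depends_integrable D); split=> //; exists l.
Qed.

Lemma mean_indic i : D i -> mean (\1_(A i)) = q i.
Proof.
move=> Di; have iD : [set` [fset i]%fset] `<=` D by move=> j /=; rewrite inE => /eqP ->.
have := mean_monomial 1 iD; rewrite big_seq_fset1 mul1r => <-; congr mean.
by apply/funext => w; rewrite /monomial big_seq_fset1 mul1r.
Qed.

(** Expand both polynomials: monomials over disjoint index sets multiply to a monomial over the
    disjoint union, whose mean is the product of the two means. *)
Lemma mean_indepM S S' F G : S `&` S' = set0 -> depends S F -> depends S' G ->
  mean (fun w => F w * G w) = mean F * mean G.
Proof.
move=> SS' [SD [l lS ->]] [S'D [k kS ->]].
rewrite (mean_polynomial (l := k)); last by move=> cJ /kS h; exact: subset_trans h S'D.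
rewrite (mean_polynomial (l := l)); last by move=> cJ /lS h; exact: subset_trans h SD.
have -> : (fun w => polynomial l w * polynomial k w) =
    polynomial (flatten [seq mul1 cJ k | cJ <- l]).
  apply/funext => w; elim: l {lS} => /= [|cJ l IH].
    by rewrite /polynomial !big_nil mul0r.
  by rewrite polynomial_cat polynomial_cons mulrDl IH polynomial_mul1.
rewrite mean_polynomial; last first.
  move=> cJ /flatten_mapP[e /lS eS /mapP[f /kS fS ->]] i /=.
  by rewrite inE => /orP[/eS/SD|/fS/S'D].
rewrite big_flatten big_map mulr_suml big_seq [RHS]big_seq.
apply: eq_bigr => -[c J] /lS /= JS; rewrite big_map mulr_sumr big_seq [RHS]big_seq.
apply: eq_bigr => -[e K] /kS /= KS.
rewrite /= (perm_big (J ++ K)) /=; first by rewrite big_cat /= mulrACA.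
apply: uniq_perm => [||i]; rewrite ?fset_uniq ?inE ?mem_cat //.
rewrite cat_uniq !fset_uniq andbT /=; apply/hasPn => i iK; apply/negP => iJ.
have SS'i : (S `&` S') i by split; [exact: JS|exact: KS].
by rewrite SS' in SS'i.
Qed.

Lemma markov_ge S F (c : R) : depends S F -> (forall w, 0 <= F w) -> 0 < c ->
  measurable [set w | (c <= F w)%R] /\ (mu [set w | (c <= F w)%R] <= (mean F / c)%:E)%E.
Proof.
move=> /depends_integrable iF F0 c0.
have mF : measurable [set w | (c <= F w)%R].
  have := measurable_int _ iF; move=> /measurable_EFinP mF.
    have := mF measurableT `[c, +oo[%classic (measurable_itv _).
  rewrite setTI; have -> // : F @^-1` `[c, +oo[%classic = [set w | (c <= F w)%R].
  by apply/seteqP; split=> w /=; rewrite in_itv /= andbT.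
split=> //; rewrite -[mu _]fineK ?fin_num_measure // lee_fin ler_pdivlMr //.
rewrite mulrC; have -> : fine (mu [set w | (c <= F w)%R]) = mean (\1_[set w | (c <= F w)%R]).
  by rewrite /mean /Rintegral integral_indic // setIT.
rewrite /mean -RintegralZl //; last exact: integrable_indic.
apply: le_Rintegral => //.
  exact: (integrableZl measurableT c (integrable_indic mu mF)).
move=> w _; rewrite indicE; have [cF|] := boolP (w \in _); last by rewrite mulr0.
by rewrite mulr1; move: cF; rewrite inE.
Qed.

Lemma depends_sum S (J : eqType) (s : seq J) (F : J -> T -> R) : S `<=` D ->
  (forall j, j \in s -> depends S (F j)) ->
  depends S (fun w => \sum_(j <- s) F j w) /\
  mean (fun w => \sum_(j <- s) F j w) = \sum_(j <- s) mean (F j).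
Proof.
move=> SD; elim: s => [|j s IH] dF.
  under eq_fun do rewrite big_nil; rewrite big_nil mean_cst.
  by split=> //; exact: depends_cst.
have dFj : depends S (F j) by apply: dF; exact: mem_head.
have [|dS mS] := IH; first by move=> k ks; apply: dF; rewrite inE ks orbT.
under eq_fun do rewrite big_cons; rewrite big_cons -mS -(meanD dFj) //.
by split=> //; exact: dependsD.
Qed.

Lemma depends_prod (J : eqType) (s : seq J) (S : J -> set I) (F : J -> T -> R) :
  uniq s -> (forall j, j \in s -> depends (S j) (F j)) ->
  (forall j k, j \in s -> k \in s -> j != k -> S j `&` S k = set0) ->
  depends (\bigcup_(j in [set` s]) S j) (fun w => \prod_(j <- s) F j w) /\
  mean (fun w => \prod_(j <- s) F j w) = \prod_(j <- s) mean (F j).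
Proof.
elim: s => [|j s IH] us dF disj.
  have -> : (fun w => \prod_(j <- [::]) F j w) = (fun=> 1 : R).
    by apply/funext => w; rewrite big_nil.
  by rewrite big_nil mean_cst; split=> //; apply: depends_cst => i [].
have /andP[js us'] := us.
have [|k l ks ls|dP mP] := IH us'.
- by move=> k ks; apply: dF; rewrite inE ks orbT.
- by apply: disj; rewrite inE ?ks ?ls orbT.
have dj : depends (S j) (F j) by apply: dF; exact: mem_head.
have -> : (fun w => \prod_(k <- j :: s) F k w) =
    (fun w => F j w * \prod_(k <- s) F k w).
  by apply/funext => w; rewrite big_cons.
rewrite big_cons -mP; split; last first.
  apply: mean_indepM dj dP; rewrite -subset0 => i [Sji [k /= ks Ski]].
  have jk : j != k by apply: contraNneq js => ->.
  have kjs : k \in j :: s by rewrite inE ks orbT.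
  by have := disj j k (mem_head _ _) kjs jk; rewrite -subset0 => /(_ i); apply; split.
have SD : \bigcup_(k in [set` j :: s]) S k `<=` D.
  by move=> i [k kjs]; case: (dF k kjs) => + _; apply.
apply: dependsM.
  by apply: depends_sub dj => // i Si; exists j => //=; rewrite mem_head.
apply: depends_sub dP => // i [k /= ks Ski]; exists k => //=.
by rewrite inE ks orbT.
Qed.

Lemma mean_indicM S i G : D i -> ~ S i -> depends S G ->
  depends (i |` S) (fun w => \1_(A i) w * G w) /\
  mean (fun w => \1_(A i) w * G w) = q i * mean G.
Proof.
move=> Di nSi dG; have di := depends_indic Di; have SD := dG.1; split; last first.
  rewrite -(mean_indic Di); apply: mean_indepM di dG.
  by rewrite -subset0 => j [-> /nSi].
have iSD : i |` S `<=` D by move=> j [->|/SD].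
apply: dependsM.
  by apply: depends_sub di => // j; left.
by apply: depends_sub dG => // j; right.
Qed.

(* The effect of a first edge, open with probability [q i], on a generating
   function. *)
Lemma mean_thinning S i G : D i -> ~ S i -> depends S G ->
  depends (i |` S) (fun w => 1 - \1_(A i) w * (1 - G w)) /\
  mean (fun w => 1 - \1_(A i) w * (1 - G w)) = 1 - q i * (1 - mean G).
Proof.
move=> Di nSi dG; have SD := dG.1.
have dN S' F : depends S' F -> depends S' (fun w => 1 + -1 * F w) /\
    mean (fun w => 1 + -1 * F w) = 1 - mean F.
  move=> dF; have c1 := depends_cst 1 dF.1; have dNF := dependsM (depends_cst (-1) dF.1) dF.
  split; first exact: dependsD.
  by rewrite (meanD c1 dNF) mean_cst (meanZ _ dF) mulN1r.
have E F : (fun w : T => 1 - F w) = (fun w => 1 + -1 * F w) :> (T -> R).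
  by apply/funext => w; rewrite mulN1r.
have [dG' mG'] := dN _ _ dG; rewrite -E in dG' mG'.
have [dH mH] := mean_indicM Di nSi dG'.
by have := dN _ _ dH; rewrite -E mH mG'.
Qed.

End IndependentEvents.

(** * Generation sizes under percolation *)

Section Generations.
Variables (V : choiceType) (T : graph V) (h : V -> int).
Variables (par : V -> V) (ch : V -> seq V) (ed : V -> edge T).
Hypothesis HT : horotree h par ch ed.
Variables (R : realType) (mu : probability (config T) R) (q : V -> R) (c : seq R).
Hypothesis c01 : forall x, x \in c -> 0 <= x <= 1.
Hypothesis qc : forall x, vset T x -> perm_eq [seq q y | y <- ch x] c.

Let A (z : V) : set (config T) := [set w | w (ed z)].

Hypothesis mA : forall z, vset T z -> measurable (A z).
Hypothesis indep : forall J : {fset V}, [set` J] `<=` vset T ->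
  mu (\bigcap_(z in [set` J]) A z) = (\prod_(z <- J) q z)%:E.

Let Z n x (w : config T) : nat := size (desc ch ed w n x).
Let m := \sum_(x <- c) x.

Let dep := @depends _ (config T) R V A (vset T).

(** Vertices stand for the edges above them: [below x] is the edge set of the subtree under [x], and
    [family y] adds the edge from [y] to its parent. *)
Let below x := [set z | vset T z /\ exists i, iter i.+1 par z = x].
Let family y := [set z | vset T z /\ exists i, iter i par z = y].

Let below_vset x : below x `<=` vset T. Proof. by move=> z []. Qed.

Let below_family y : below y `<=` family y.
Proof. by move=> z [Tz [i iz]]; split=> //; exists i.+1. Qed.

Let family_below x y : vset T x -> y \in ch x -> family y `<=` below x.
Proof.
move=> Tx /(ht_mem HT _ Tx)[Ty yx] z [Tz [i iz]].
by split=> //; exists i; rewrite /= iz.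
Qed.

(** A common descendant would be equally many generations below both siblings, as they have the same
    level, so they would be the same iterated parent. *)
Let siblings_disjoint x y z : vset T x -> y \in ch x -> z \in ch x -> y != z ->
  family y `&` family z = set0.
Proof.
move=> Tx /(ht_mem HT _ Tx)[Ty yx] /(ht_mem HT _ Tx)[Tz zx] /eqP yz.
rewrite -subset0 => v [[Tv [i iv]] [_ [j jv]]]; apply: yz.
have := level_iter_par HT i Tv; have := level_iter_par HT j Tv.
rewrite iv jv => hz hy; have := ht_level_par HT Ty; have := ht_level_par HT Tz.
rewrite yx zx => hxz hxy.
have ij : i = j by lia.
by rewrite -iv -jv ij.
Qed.

Let sizeS n x w :
  (Z n.+1 x w)%:R = \sum_(y <- ch x) \1_(A y) w * (Z n y w)%:R :> R.
Proof.
rewrite /Z /=; elim: (ch x) => [|y s IH] /=; first by rewrite big_nil.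
rewrite big_cons -IH indicE; have [wy|nwy] := boolP (w (ed y)) => /=.
  by rewrite mem_set // mul1r size_cat natrD.
by rewrite memNset ?mul0r ?add0r //; apply/negP.
Qed.

(** The factor of a child is u^Z if its edge is open and 1 if it is closed. *)
Let powS u n x w :
  u ^+ Z n.+1 x w = \prod_(y <- ch x) (1 - \1_(A y) w * (1 - u ^+ Z n y w)) :> R.
Proof.
rewrite /Z /=; elim: (ch x) => [|y s IH] /=; first by rewrite big_nil.
rewrite big_cons -IH indicE; have [wy|nwy] := boolP (w (ed y)) => /=.
  by rewrite mem_set // mul1r size_cat exprD subKr.
by rewrite memNset ?mul0r ?subr0 ?mul1r //; apply/negP.
Qed.

Let not_below y : ~ below y y.
Proof.
move=> [Ty [i iy]]; have := level_iter_par HT i.+1 Ty; rewrite iy; lia.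
Qed.

Let familyE y : vset T y -> family y = y |` below y.
Proof.
move=> Ty; apply/seteqP; split=> [z [Tz [[|i] iz]]|z [->|/below_family //]].
- by left.
- by right; split=> //; exists i.
- by split=> //; exists 0%N.
Qed.

Let bigcup_family x : vset T x ->
  \bigcup_(y in [set` ch x]) family y `<=` below x.
Proof. by move=> Tx z [y ych]; exact: family_below. Qed.

(** Siblings involve disjoint families of edges, so the mean of the product in [powS] factorises
    into one application of [pgf]. The dependence is carried through the induction for this
    purpose. *)
Lemma mean_pow_generation (u : R) n x : vset T x ->
  dep (below x) (fun w => u ^+ Z n x w) /\
  mean mu (fun w => u ^+ Z n x w) = iter n (pgf c) u.
Proof.
elim: n x => [|n IH] x Tx.
  by rewrite mean_cst; split=> //; exact: depends_cst.
have -> : (fun w => u ^+ Z n.+1 x w) =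
    (fun w => \prod_(y <- ch x) (1 - \1_(A y) w * (1 - u ^+ Z n y w))).
  by apply/funext => w; exact: powS.
have thin y : y \in ch x ->
    dep (family y) (fun w => 1 - \1_(A y) w * (1 - u ^+ Z n y w)) /\
    mean mu (fun w => 1 - \1_(A y) w * (1 - u ^+ Z n y w)) =
      1 - q y * (1 - iter n (pgf c) u).
  move=> /(ht_mem HT _ Tx)[Ty _]; have [dZ <-] := IH _ Ty.
  by rewrite familyE //; exact: (mean_thinning mA indep Ty (@not_below y) dZ).
have [y z ych zch yz|dP ->] := depends_prod mA indep (ht_uniq HT Tx)
  (fun y ych => (thin y ych).1); first exact: siblings_disjoint Tx ych zch yz.
split; first exact: depends_sub (bigcup_family Tx) (@below_vset x) dP.
rewrite iterS /pgf -(perm_big _ (qc Tx)) big_map.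
by apply: eq_big_seq => y /thin[].
Qed.

Lemma mean_generation n x : vset T x ->
  dep (below x) (fun w => (Z n x w)%:R) /\
  mean mu (fun w => (Z n x w)%:R) = m ^+ n.
Proof.
elim: n x => [|n IH] x Tx.
  by rewrite mean_cst; split=> //; exact: depends_cst.
have -> : (fun w => (Z n.+1 x w)%:R) =
    (fun w => \sum_(y <- ch x) \1_(A y) w * (Z n y w)%:R) :> (_ -> R).
  by apply/funext => w; exact: sizeS.
have thin y : y \in ch x ->
    dep (below x) (fun w => \1_(A y) w * (Z n y w)%:R) /\
    mean mu (fun w => \1_(A y) w * (Z n y w)%:R) = q y * m ^+ n.
  move=> ych; have [Ty _] := (ht_mem HT _ Tx).1 ych; have [dZ <-] := IH _ Ty.
  have [dM mM] := mean_indicM mA indep Ty (@not_below y) dZ; split=> //.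
  apply: depends_sub dM => //; rewrite -familyE //; exact: family_below.
have [dS ->] := depends_sum mu mA (@below_vset x) (fun y ych => (thin y ych).1).
have mE : m = \sum_(y <- ch x) q y.
  by rewrite /m -(perm_big _ (qc Tx)) big_map.
split=> //; rewrite exprS {1}mE mulr_suml.
by apply: eq_big_seq => y /thin[].
Qed.

Hypotheses (c1 : 1 \in c) (m1 : 1 <= m).

(* [s] is [1] on the finitely many generations where there is no estimate, and
   [2 u_j^(Z_j)] afterwards. *)
Lemma typical_generations (eps : R) : 0 < eps ->
  exists delta K : R, [/\ 0 < delta, 0 < K & exists n0, forall n x,
    (n0 <= n)%N -> vset T x ->
  exists E : set (config T), [/\ measurable E, (mu E <= eps%:E)%E &
    forall w, ~ E w -> (forall j, (0 < Z j x w)%N) ->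
    (Z n x w)%:R <= K * m ^+ n /\
    exists s : nat -> R, [/\ forall j, 0 <= s j,
      forall j, (j <= n)%N -> delta * (1 - s j) * m ^+ j <= (Z j x w)%:R &
      \sum_(j <- iota 0 n.+1) s j <= n.+1%:R / 4]]].
Proof.
move=> eps0; have m0 : 0 < m by exact: lt_le_trans m1.
have [|delta [delta0 [n1 uP]]] := iter_pgf_small c01 (eps := eps / 16) c1 m1.
  lra.
have /choice[u uP'] j : exists v : R, (n1 <= j)%N ->
    [/\ 0 <= v <= 1, iter j (pgf c) v <= eps / 16 &
     forall Z, (0 < Z)%N -> delta * (1 - 2 * v ^+ Z) * m ^+ j <= Z%:R].
  have [/uP [v vP]|] := leqP n1 j; first by exists v.
  by exists 0.
exists delta, (4 / eps); split=> //; first by rewrite divr_gt0.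
(* Beyond [n2], the [n1] generations without an estimate weigh at most [eps / 16] in the average
   over all [n.+1]. *)
have [n2 n2P] : exists n2 : nat, 16 * n1%:R / eps <= n2%:R.
  exists (Num.bound (16 * n1%:R / eps)); apply/ltW/archi_boundP.
  by rewrite divr_ge0 ?mulr_ge0 //; lra.
exists n2 => n x n2n Tx.
pose s j (w : config T) : R := if (j < n1)%N then 1 else 2 * u j ^+ Z j x w.
have ds j : dep (below x) (s j) /\ mean mu (s j) <= (j < n1)%:R + eps / 8.
  rewrite /s; case: ltnP => n1j.
    by rewrite mean_cst; split; [exact: depends_cst|rewrite lerDl; lra].
  have [dP mP] := @mean_pow_generation (u j) j x Tx.
  have [_ uj _] := uP' j n1j.
  split; first by apply: dependsM => //; exact: depends_cst.
  by rewrite (meanZ mu mA _ dP) mP add0r; lra.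
have s0 j w : 0 <= s j w.
  rewrite /s; case: ltnP => // n1j; rewrite mulr_ge0 // exprn_ge0 //.
  by have [/andP[]] := uP' j n1j.
have [dZ mZ] := mean_generation n Tx.
have [dS mS] := depends_sum mu mA (s := iota 0 n.+1) (@below_vset x)
  (fun j _ => (ds j).1).
(* [Q] adds the average of the [s j] to [eps / 16] times the normalised size Z_n / m^n. Its mean is
   at most eps/16 + eps/8 + eps/16 = eps/4, so it reaches 1/4 with probability at most [eps]. Below
   1/4, the average is at most 1/4 and Z_n <= (4 / eps) m^n. *)
set a := n.+1%:R^-1 : R; set b := eps / 16 * m^-1 ^+ n.
have a0 : 0 < a by rewrite invr_gt0.
have aE : a * n.+1%:R = 1 by rewrite mulVf.
have b0 : 0 < b by rewrite mulr_gt0 ?exprn_gt0 ?invr_gt0 //; lra.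
pose Q (w : config T) : R := a * (\sum_(j <- iota 0 n.+1) s j w) + b * (Z n x w)%:R.
have dcst (v : R) := depends_cst A v (@below_vset x).
have d1 := dependsM (dcst a) dS; have d2 := dependsM (dcst b) dZ.
have dQ : dep (below x) Q by exact: dependsD.
have mQ : mean mu Q <= eps / 4.
  rewrite (meanD mu mA d1 d2) (meanZ mu mA _ dS) (meanZ mu mA _ dZ).
  rewrite mZ mS /b -mulrA -exprMn mulVf ?expr1n ?mulr1; last by lra.
  have : \sum_(j <- iota 0 n.+1) mean mu (s j) <= n1%:R + n.+1%:R * (eps / 8).
    have : \sum_(j <- iota 0 n.+1) mean mu (s j) <=
        \sum_(j <- iota 0 n.+1) ((j < n1)%:R + eps / 8).
      by apply: ler_sum => j _; case: (ds j).
    move=> /le_trans; apply; rewrite big_split; apply: lerD.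
      rewrite -natr_sum ler_nat.
      have -> : (\sum_(j <- iota 0 n.+1) (j < n1) = count (ltn^~ n1) (iota 0 n.+1))%N.
        by rewrite -sum1_count [RHS]big_mkcond; apply: eq_bigr => j _ /=; case: (j < n1)%N.
      rewrite -size_filter -[leqRHS](size_iota 0).
      rewrite uniq_leq_size ?filter_uniq ?iota_uniq //.
      by move=> j; rewrite mem_filter !mem_iota => /andP[].
    by rewrite big_const_seq count_predT size_iota iter_addr_0 mulr_natl.
  rewrite -(ler_pM2l a0) mulrDr (mulrA _ _ (eps / 8)) aE mul1r.
  have : a * n1%:R <= eps / 16.
    rewrite mulrC ler_pdivrMr //; apply: (@le_trans _ _ (eps / 16 * n2%:R)).
      by move: n2P; rewrite ler_pdivrMr //; lra.
    by apply: ler_wpM2l; [lra|rewrite ler_nat ltnW].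
  lra.
have Q0 w : 0 <= Q w.
  by rewrite addr_ge0 // mulr_ge0 ?sumr_ge0 // ltW.
have c40 : 0 < 4^-1 :> R by lra.
have [mE muE] := markov_ge mu mA dQ Q0 c40.
exists [set w | 4^-1 <= Q w]; split=> //.
  by apply: le_trans muE _; rewrite lee_fin ler_pdivrMr //; lra.
move=> w /negP; rewrite -ltNge => Qw Z0.
have S0 : 0 <= a * (\sum_(j <- iota 0 n.+1) s j w).
  by rewrite mulr_ge0 ?sumr_ge0 // ltW.
have bZ0 : 0 <= b * (Z n x w)%:R by rewrite mulr_ge0 // ltW.
split.
  have : b * (Z n x w)%:R <= 4^-1 by move: Qw; rewrite /Q; lra.
  rewrite -ler_pdivlMl // /b => /le_trans; apply.
  rewrite !invfM !invrK exprVn invrK; lra.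
exists (s^~ w); split=> // [j jn|].
  rewrite /s; case: ltnP => [_|n1j]; first by rewrite subrr mulr0 mul0r.
  by have [_ _] := uP' j n1j; apply.
have : a * (\sum_(j <- iota 0 n.+1) s j w) <= 4^-1 by move: Qw; rewrite /Q; lra.
by rewrite -ler_pdivlMl // invrK mulrC.
Qed.
End Generations.

(** * Percolation measures as independent offspring *)

Section Percolation.
Variables (V : choiceType) (T : graph V) (h : V -> int).
Variables (par : V -> V) (ch : V -> seq V) (ed : V -> edge T).
Hypothesis HT : horotree h par ch ed.
Variables (R : realType) (mu : probability (config T) R) (mk : pred (edge T)).
Variable p : R.
Hypotheses (p01 : 0 <= p <= 1) (mu_perc : percolation_measure mk p mu).

Let A (z : V) : set (config T) := [set w | w (ed z)].

Definition retention (z : V) : R := if mk (ed z) then p else 1.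

Lemma measurable_up_open z : measurable (A z).
Proof. by apply: sub_sigma_algebra; exists (ed z). Qed.

(** Independence is assumed for marked edges only. Unmarked ones are open outside the null set [N]
    and have retention 1, so dropping them from [J] changes neither side. *)
Lemma measure_up_open (J : {fset V}) : [set` J] `<=` vset T ->
  mu (\bigcap_(z in [set` J]) A z) = (\prod_(z <- J) retention z)%:E.
Proof.
move=> JT; have [[N [mN N0 subN]] mup muind] := mu_perc.
pose J1 := [fset z in J | mk (ed z)]%fset.
have J1J z : z \in J1 -> z \in J /\ mk (ed z) by rewrite !inE => /andP[].
have mB (K : {fset V}) : measurable (\bigcap_(z in [set` K]) A z).
  by apply: fin_bigcap_measurable => [|z _]; [exact: finite_fset|exact: measurable_up_open].
have -> : mu (\bigcap_(z in [set` J]) A z) = mu (\bigcap_(z in [set` J1]) A z).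
  apply/eqP; rewrite eq_le; apply/andP; split.
    by apply: le_measure; rewrite ?inE // => w wJ z /J1J[zJ _]; exact: wJ.
  apply: (@le_trans _ _ (mu ((\bigcap_(z in [set` J]) A z) `|` N))).
    apply: le_measure; rewrite ?inE //; first exact: measurableU.
    move=> w wJ1; have [wN|nwN] := pselect (N w); [by right|left=> z zJ].
    have [mz|nmz] := boolP (mk (ed z)); first by apply: wJ1; rewrite /= !inE zJ.
    apply: contrapT => nwz; apply: nwN; apply: subN => /= hw.
    exact: nwz (hw _ nmz).
  apply: le_trans (measureU2 _ _ _) _ => //.
  by have /= -> := N0; rewrite adde0.
pose E1 := [fset ed z | z in J1]%fset.
have -> : \bigcap_(z in [set` J1]) A z = \bigcap_(e in [set` E1]) @edge_open V T e.
  apply/seteqP; split=> w /= wJ; first by move=> _ /imfsetP[z /= zJ ->]; exact: wJ.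
  by move=> z zJ; apply: (wJ (ed z)); apply/imfsetP; exists z.
rewrite muind; last by move=> _ /imfsetP[z /= /J1J[_ mz] ->].
rewrite big_imfset /=; last first.
  by move=> y z /J1J[/JT Ty _] /J1J[/JT Tz _]; exact: (up_edge_inj HT).
rewrite [LHS](_ : _ = (\prod_(z <- J1) p)%:E); last first.
  rewrite -prodEFin big_seq [RHS]big_seq; apply: eq_bigr => z /J1J[_ mz].
  exact: mup.
congr _%:E; rewrite big_fset /= big_mkcond /=; apply: eq_bigr => z _.
by rewrite /retention.
Qed.

Variables (a a0 : nat).
Hypotheses (a01 : (1 <= a0 <= a)%N).
Hypothesis ch_size : forall x, vset T x -> size (ch x) = a /\
  count (fun y => ~~ mk (ed y)) (ch x) = a0.

Let c : seq R := nseq a0 1 ++ nseq (a - a0) p.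

Let retention_perm x : vset T x -> perm_eq [seq retention y | y <- ch x] c.
Proof.
move=> /ch_size[sx cx].
have -> : c = nseq (count (fun y => ~~ mk (ed y)) (ch x)) 1 ++
    nseq (count (fun y => mk (ed y)) (ch x)) p.
  rewrite /c cx -sx -(count_predC (fun y => mk (ed y))) -[in X in nseq X p]cx.
  by rewrite addnK.
elim: (ch x) => //= y s IH; rewrite {1}/retention.
case: (mk (ed y)) => /=; last by rewrite perm_cons.
by rewrite perm_sym (perm_catCA _ [:: p]) perm_cons perm_sym.
Qed.

Definition mean_offspring : R := a0%:R + p * (a%:R - a0%:R).

Lemma mean_offspring_ge1 : 1 <= mean_offspring.
Proof.
have /andP[a01' a0a] := a01.
have a01r : 1 <= a0%:R :> R by rewrite ler1n.
have a0ar : a0%:R <= a%:R :> R by rewrite ler_nat.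
have : 0 <= p * (a%:R - a0%:R) by case/andP: p01 => p0 _; rewrite mulr_ge0 // subr_ge0.
rewrite /mean_offspring; lra.
Qed.

Lemma percolation_typical (eps : R) : 0 < eps ->
  exists delta K : R, [/\ 0 < delta, 0 < K & exists n0, forall n x,
    (n0 <= n)%N -> vset T x ->
  exists E : set (config T), [/\ measurable E, (mu E <= eps%:E)%E &
    forall w, ~ E w -> (forall j, (0 < size (desc ch ed w j x))%N) ->
    (size (desc ch ed w n x))%:R <= K * mean_offspring ^+ n /\
    exists s : nat -> R, [/\ forall j, 0 <= s j,
      forall j, (j <= n)%N ->
        delta * (1 - s j) * mean_offspring ^+ j <= (size (desc ch ed w j x))%:R &
      \sum_(j <- iota 0 n.+1) s j <= n.+1%:R / 4]]].
Proof.
have mean_offspringE : mean_offspring = \sum_(x <- c) x.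
  rewrite /c big_cat !big_nseq !iter_addr_0 /= /mean_offspring.
  by have /andP[_ a0a] := a01; rewrite -natrB // mulr_natr.
move=> eps0; rewrite mean_offspringE.
have c01 x : x \in c -> 0 <= x <= 1.
  by rewrite mem_cat !mem_nseq => /orP[]/andP[_ /eqP ->] //; rewrite ler01 lexx.
have c1 : 1 \in c by rewrite mem_cat mem_nseq eqxx; case/andP: a01 => ->.
apply: (typical_generations HT c01 retention_perm _ measure_up_open c1 _ eps0).
  by move=> z _; exact: measurable_up_open.
rewrite -mean_offspringE; exact: mean_offspring_ge1.
Qed.

(** No extinction: [a0] is at least 1, so every vertex has an unmarked edge to a child. *)
Lemma ae_open_child : {ae mu, forall w : config T,
  forall x, vset T x -> exists2 y, y \in ch x & w (ed y)}.
Proof.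
have [mu_ae _ _] := mu_perc; apply: filterS mu_ae => w wP x /ch_size[_ cx].
have /hasP[y ych ny] : has (fun y => ~~ mk (ed y)) (ch x).
  by rewrite has_count cx; case/andP: a01.
by exists y => //; exact: wP.
Qed.

End Percolation.

(** * Tetrahedra in the horocyclic product *)

Lemma card_set_seq (I : choiceType) (s : seq I) : uniq s ->
  ([set` s] #= `I_(size s))%card.
Proof.
move=> us; have -> : [set` s] = [set` [fset x in s]%fset].
  by apply/seteqP; split=> x /=; rewrite inE.
by apply/card_eq_fsetP; rewrite card_fseq undup_id.
Qed.

Lemma counting_le_size (R : realType) (I : choiceType) (A : set I) (s : seq I) :
  A `<=` [set` s] -> ((counting A : \bar R) <= (size s)%:R%:E)%E.
Proof.
move=> As; have fs : finite_set [set` s] by exact: finite_seq.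
have fA : finite_set A by apply: sub_finite_set fs.
rewrite /counting asboolT // lee_fin ler_nat.
apply: (@leq_trans #|` [fset x in s]%fset|); last by rewrite card_fseq size_undup.
apply: fsubset_leq_card; apply/fsubsetP => x.
by rewrite in_fset_set // !inE => /As.
Qed.

Section Descendants.
Variables (V : choiceType) (T : graph V) (h : V -> int).
Variables (par : V -> V) (ch : V -> seq V) (ed : V -> edge T).
Hypothesis HT : horotree h par ch ed.
Variable w : edge T -> bool.

Lemma desc_child n x y : vset T x -> vset T y -> w (ed y) ->
  par y \in desc ch ed w n x -> y \in desc ch ed w n.+1 x.
Proof.
move=> Tx Ty wy /(mem_desc HT _ _ _ Tx)[_ yx wp]; apply/(mem_desc HT) => //.
by rewrite iterSr; split=> // -[|i] // ni; rewrite iterSr; apply: wp.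
Qed.

Lemma desc_par n x y : vset T x -> y \in desc ch ed w n.+1 x ->
  w (ed y) /\ par y \in desc ch ed w n x.
Proof.
move=> Tx /(mem_desc HT _ _ _ Tx)[Ty yx wy]; split; first exact: (wy 0%N).
apply/(mem_desc HT) => //; rewrite -iterSr; split=> //; first exact: (vset_par HT).
by move=> i ni; rewrite -iterSr; apply: wy.
Qed.

Lemma desc_iter_par n i x y : vset T x -> (i <= n)%N -> y \in desc ch ed w n x ->
  iter i par y \in desc ch ed w (n - i) x.
Proof.
move=> Tx; elim: i => [|i IH] ni yx; first by rewrite subn0.
have := IH (ltnW ni) yx; rewrite -(@subnSK i n) // => /(desc_par Tx)[_].
exact.
Qed.

Hypothesis open_child : forall x, vset T x -> exists2 y, y \in ch x & w (ed y).

Lemma desc_nonempty n x : vset T x -> (0 < size (desc ch ed w n x))%N.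
Proof.
move=> Tx; rewrite lt0n size_eq0; suff [y yx] : exists y, y \in desc ch ed w n x.
  by apply/eqP => d0; rewrite d0 in yx.
elim: n => [|n [y yx]]; first by exists x; exact: mem_head.
have Ty := desc_vset HT Tx yx; have [z /(ht_mem HT _ Ty)[Tz zy] wz] := open_child Ty.
by exists z; apply: desc_child => //; rewrite zy.
Qed.

End Descendants.

Section Tetrahedron.
Variables (V' V : choiceType) (T' : graph V') (T : graph V).
Variables (h' : V' -> int) (h : V -> int).
Variables (par' : V' -> V') (ch' : V' -> seq V') (ed' : V' -> edge T').
Variables (par : V -> V) (ch : V -> seq V) (ed : V -> edge T).
Hypotheses (HT' : horotree h' par' ch' ed') (HT : horotree h par ch ed).
Variables (w' : edge T' -> bool) (w : edge T -> bool).
Hypothesis open_child' : forall x, vset T' x -> exists2 y, y \in ch' x & w' (ed' y).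
Hypothesis open_child : forall x, vset T x -> exists2 y, y \in ch x & w (ed y).

Let H := horo h' h (open_graph w') (open_graph w).
Let D' := desc ch' ed' w'.
Let D := desc ch ed w.

Lemma horo_up_down u y : vset T' u -> vset T y -> h' u = - h (par y) ->
  w' (ed' u) -> w (ed y) -> adj H (u, par y) (par' u, y).
Proof.
move=> Tu Ty huy wu wy; apply/and4P; split => /=.
- by apply/mem_set; split => //=; exact: (vset_par HT).
- apply/mem_set; split => //=; first exact: (vset_par HT').
  by rewrite (ht_level_par HT') // huy (ht_level_par HT) //; lia.
- by rewrite (open_up_edge HT').
- by rewrite open_adj_sym (open_up_edge HT).
Qed.

(** Opposite levels rule out moving up, or down, in both trees at once. *)
Lemma horo_adjP k l : adj H k l ->
  [/\ l.1 = par' k.1, w' (ed' k.1), k.2 = par l.2 & w (ed l.2)] \/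
  [/\ k.1 = par' l.1, w' (ed' l.1), l.2 = par k.2 & w (ed k.2)].
Proof.
case/and4P => /set_mem[Tk1 Tk2 hk] /set_mem[Tl1 Tl2 hl].
move=> /(open_adjP HT')[[E1 w1]|[E1 w1]] /(open_adjP HT)[[E2 w2]|[E2 w2]].
- exfalso; move: hl; rewrite E1 E2.
  by rewrite (ht_level_par HT') // (ht_level_par HT) // hk; lia.
- by left.
- by right.
- exfalso; move: hk; rewrite E1 E2.
  by rewrite (ht_level_par HT') // (ht_level_par HT) // hl; lia.
Qed.

Variables (x' : V') (x : V) (n : nat).
Hypotheses (Tx' : vset T' x') (Tx : vset T x) (hxx : h' x' = - h x - n%:Z).

(** Given [hxx], the condition [r + j = n] is exactly the level constraint of the horocyclic
    product. *)
Definition tetrahedron : set (V' * V) :=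
  [set k | exists r j, [/\ (r + j = n)%N, k.1 \in D' r x' & k.2 \in D j x]].

Let P := induced_subgraph H tetrahedron.

Lemma tetrahedron_vset : tetrahedron `<=` vset H.
Proof.
move=> k [r [j [rj k1 k2]]]; split=> /=.
- exact (desc_vset HT' Tx' k1).
- exact (desc_vset HT Tx k2).
- by rewrite (desc_level HT' Tx' k1) (desc_level HT Tx k2) hxx; lia.
Qed.

Let P_linked r j u y : (r.+1 + j = n)%N -> u \in D' r.+1 x' -> y \in D j.+1 x ->
  linked P (u, par y) (par' u, y).
Proof.
move=> rj uD yD; apply: adj_linked.
have [wu pu] := desc_par HT' Tx' uD; have [wy py] := desc_par HT Tx yD.
have tk : tetrahedron (u, par y) by exists r.+1, j.
have [_ _ huy] := tetrahedron_vset tk.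
apply/and3P; split; last 2 first.
- exact/mem_set.
- by apply/mem_set; exists r, j.+1; split=> //; lia.
- by apply: horo_up_down => //; [exact (desc_vset HT' Tx' uD)|exact (desc_vset HT Tx yD)].
Qed.

Let linked_apex r j u v : (r + j = n)%N -> u \in D' r x' -> v \in D j x ->
  exists2 z, z \in D n x & linked P (u, v) (x', z).
Proof.
elim: r j u v => [|r IH] j u v rj uD vD.
  exists v; first by rewrite -rj.
  by move: uD; rewrite inE => /eqP ->; exact: linked_refl.
have Tv := desc_vset HT Tx vD; have [y /(ht_mem HT _ Tv)[Ty yv] wy] := open_child Tv.
have yD : y \in D j.+1 x by apply: (desc_child HT) => //; rewrite yv.
have [_ puD] := desc_par HT' Tx' uD.
have [|z zD pz] := IH j.+1 (par' u) y _ puD yD; first by lia.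
by exists z => //; apply: linked_trans pz; rewrite -yv; apply: P_linked uD yD.
Qed.

Let linked_apices u z : u \in D' n x' -> z \in D n x -> linked P (x', z) (u, x).
Proof.
move=> uD zD.
have un : iter n par' u = x' by have [] := (mem_desc HT' _ _ _ Tx').1 uD.
have zn : iter n par z = x by have [] := (mem_desc HT _ _ _ Tx).1 zD.
suff step j : (j <= n)%N -> linked P (x', z) (iter (n - j) par' u, iter j par z).
  by have := step n (leqnn n); rewrite subnn zn.
elim: j => [|j IH] jn; first by rewrite subn0 un; exact: linked_refl.
apply: linked_trans (IH (ltnW jn)) _; apply: linked_sym.
rewrite -(@subnSK j n) //=.
apply: (@P_linked j (n - j.+1)); first by lia.
- have := desc_iter_par HT' Tx' (leq_subr j.+1 n) uD.
  by rewrite subKn.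
- have := desc_iter_par HT Tx (ltnW jn) zD.
  by rewrite -(@subnSK j n).
Qed.

(** Fix [u] at the bottom of the first tree. From any vertex, climb to [x'] while descending through
    open children in the second tree, then climb to [x] while descending in the first tree along the
    ancestors of [u]. All vertices are so linked to [(u, x)]. *)
Lemma tetrahedron_connected : connected_graph P.
Proof.
have [u uD] : exists u, u \in D' n x'.
  have := desc_nonempty HT' open_child' n Tx'; rewrite -/(D' n x').
  by case: (D' n x') => // u s _; exists u; exact: mem_head.
have toux k : vset P k -> linked P k (u, x).
  case: k => k1 k2 [_ [r [j [rj k1D k2D]]]].
  have [z zD kz] := linked_apex rj k1D k2D.
  exact: linked_trans kz (linked_apices uD zD).
by move=> k l /toux ku /toux lu; apply: linked_trans ku (linked_sym lu).
Qed.

Definition tetrahedron_size : nat :=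
  \sum_(j <- iota 0 n.+1) size (D' (n - j) x') * size (D j x).

Lemma tetrahedron_card : (vset P #= `I_tetrahedron_size)%card.
Proof.
pose L := flatten [seq [seq (u, v) | u <- D' (n - j) x', v <- D j x] | j <- iota 0 n.+1].
have -> : vset P = [set` L].
  apply/seteqP; split=> [[u v] [_ [r [j [/= rj uD vD]]]]|k /flatten_mapP[j jn]] /=.
    apply/flatten_mapP; exists j; first by rewrite mem_iota; lia.
    by apply/allpairsP; exists (u, v); split=> //=; rewrite -rj addnK.
  move: jn; rewrite mem_iota => jn /allpairsP[[u v] /= [uD vD ->]].
  have t : tetrahedron (u, v) by exists (n - j)%N, j; split=> //; lia.
  by split=> //; exact: tetrahedron_vset.
have -> : tetrahedron_size = size L.
  rewrite size_flatten /shape -map_comp sumnE big_map.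
  by apply: eq_bigr => j _ /=; rewrite size_allpairs.
apply: card_set_seq; apply: uniq_flatten_map; first exact: iota_uniq.
  move=> j _; apply: allpairs_uniq; [exact: desc_uniq HT' _ _ _ Tx'|exact: desc_uniq HT _ _ _ Tx|].
  by move=> [? ?] [? ?] _ _ [-> ->].
move=> i j k _ _ /allpairsP[[u v] /= [_ vi ->]] /allpairsP[[u1 v1] /= [_ vj [_ E]]].
move: vj; rewrite -E => vj.
by have := desc_level HT Tx vi; rewrite (desc_level HT Tx vj); lia.
Qed.

Lemma tetrahedron_finite : finite_set tetrahedron.
Proof.
have : finite_set (vset P) by apply/finite_setP; exists tetrahedron_size; exact: tetrahedron_card.
by apply: sub_finite_set => k tk; split=> //; exact: tetrahedron_vset.
Qed.

(** A step trades one generation of [r] against one of [j], so it leaves only when the climbing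
    coordinate is already an apex; the other one is then in generation [n] and drops below it. *)
Lemma tetrahedron_exit k l : tetrahedron k -> adj H k l ->
  [\/ tetrahedron l,
      [/\ w' (ed' x'), l.1 = par' x' & exists2 v, v \in D n x & l.2 \in ch v] |
      [/\ w (ed x), l.2 = par x & exists2 u, u \in D' n x' & l.1 \in ch' u]].
Proof.
move=> [r [j [rj k1D k2D]]] /[dup] /horo_adjP kl; rewrite adj_sym => /adj_vset[Tl1 Tl2 _].
case: kl => -[E1 w1 E2 w2].
- case: r rj k1D => [|r] rj k1D; last first.
    constructor 1; exists r, j.+1; split; first by lia.
      by rewrite E1; have [] := desc_par HT' Tx' k1D.
    by apply: (desc_child HT) => //; rewrite -E2.
  constructor 2; move: k1D w1; rewrite inE E1 => /eqP -> w1; split=> //.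
  exists k.2; first by rewrite -rj.
  by apply/(ht_mem HT); rewrite ?E2 //; exact: (vset_par HT).
- case: j rj k2D => [|j] rj k2D; last first.
    constructor 1; exists r.+1, j; split; first by lia.
      by apply: (desc_child HT') => //; rewrite -E1.
    by rewrite E2; have [] := desc_par HT Tx k2D.
  constructor 3; move: k2D w2; rewrite inE E2 => /eqP -> w2; split=> //.
  exists k.1; first by rewrite -rj addn0.
  by apply/(ht_mem HT'); rewrite ?E1 //; exact: (vset_par HT').
Qed.

Variables (a' a : nat).
Hypotheses (ch_size' : forall y, vset T' y -> size (ch' y) = a')
  (ch_size : forall y, vset T y -> size (ch y) = a).
Variable root : V' * V.
Hypothesis root_in : tetrahedron root.
Variable R : realType.

Let Gamma := induced_subgraph H (component H root).

Let tetrahedron_component : tetrahedron `<=` component H root.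
Proof.
move=> k tk; split; first exact: tetrahedron_vset.
have vP l : tetrahedron l -> vset P l by move=> tl; split=> //; exact: tetrahedron_vset.
have [s ps ls] := tetrahedron_connected (vP _ root_in) (vP _ tk).
by exists s => //; apply: sub_path ps => y z /and3P[].
Qed.

Lemma tetrahedron_ratio : exists F,
  [/\ subgraph F Gamma, connected_graph F, (vset F #= `I_tetrahedron_size)%card &
      vset F root] /\
  (iso_ratio R Gamma F <=
    ((a' * size (D' n x') + a * size (D n x))%:R / tetrahedron_size%:R)%:E)%E.
Proof.
exists P; split.
  split; [split|exact: tetrahedron_connected|exact: tetrahedron_card|].
  - by move=> k [Hk /tetrahedron_component Ck].
  - move=> k l /and3P[kl /set_mem tk /set_mem tl].
    by apply/and3P; split=> //; apply/mem_set; exact: tetrahedron_component.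
  - by split=> //; exact: tetrahedron_vset.
rewrite /iso_ratio (card_fset_set tetrahedron_card) EFinM.
apply: lee_wpmul2r; first by rewrite lee_fin invr_ge0.
(* [M] lists all possible exits, counting children across open and closed edges alike, whence the
   factors [a'] and [a]. *)
pose M := [seq (y, par x) | y <- flatten (map ch' (D' n x'))] ++
  [seq (par' x', y) | y <- flatten (map ch (D n x))].
have sM : size M = (a' * size (D' n x') + a * size (D n x))%N.
  rewrite size_cat !size_map (@size_flatten_const _ _ _ a') ?(@size_flatten_const _ _ _ a) //.
  - by move=> y yD; apply: ch_size; exact (desc_vset HT Tx yD).
  - by move=> y yD; apply: ch_size'; exact (desc_vset HT' Tx' yD).
rewrite -sM; apply: counting_le_size => l [_ nl [k [_ tk] /and3P[kl _ _]]].
have Hl : vset H l by move: kl; rewrite adj_sym => /adj_vset.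
rewrite /M /= mem_cat; case: (tetrahedron_exit tk kl) => [tl|[_ l1 [v vD l2]]|[_ l2 [u uD l1]]].
- by case: nl.
- apply/orP; right; apply/mapP; exists l.2; last by rewrite -l1; case: (l).
  by apply/flatten_mapP; exists v.
- apply/orP; left; apply/mapP; exists l.1; last by rewrite -l2; case: (l).
  by apply/flatten_mapP; exists u.
Qed.

Lemma closed_tetrahedron_component : ~~ w' (ed' x') -> ~~ w (ed x) ->
  finite_set (component H root).
Proof.
move=> nw' nw; apply: sub_finite_set tetrahedron_finite => k [_ [s ps <-]].
elim: s root root_in ps => //= y s IH k0 tk0 /andP[k0y]; apply: IH.
by case: (tetrahedron_exit tk0 k0y) => // -[we _ _]; move: we; rewrite (negbTE nw', negbTE nw).
Qed.

End Tetrahedron.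

(** * Almost sure amenability *)

Lemma limn_einf_eq0 (R : realType) (u : nat -> \bar R) :
  (forall n, 0 <= u n)%E ->
  (forall (eps : R) N, 0 < eps -> exists2 n, (N <= n)%N & (u n <= eps%:E)%E) ->
  limn_einf u = 0%E.
Proof.
move=> u0 us; rewrite limn_einf_lim; have -> : einfs u = cst 0%E; last exact: lim_cst.
apply/funext => N; apply/eqP; rewrite eq_le /einfs /=; apply/andP; split.
  apply/lee_addgt0Pr => eps eps0; rewrite add0e.
  have [n Nn un] := us eps N eps0; apply: le_trans un.
  by apply: ereal_inf_lbound; exists n.
by apply: le_ereal_inf_tmp => _ [n _ <-].
Qed.

(** Intersect covers of measure at most 1/(k+1). [A] itself may fail to be measurable. *)
Lemma negligible_small_cover d (T : measurableType d) (R : realType)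
    (P : {measure set T -> \bar R}) (A : set T) :
  (forall eps : R, 0 < eps ->
     exists U, [/\ measurable U, A `<=` U & (P U <= eps%:E)%E]) ->
  P.-negligible A.
Proof.
move=> small.
have /choice[U UP] k : exists U, [/\ measurable U, A `<=` U & (P U <= (k.+1%:R^-1)%:E)%E].
  by apply: small.
have mU : measurable (\bigcap_k U k) by apply: bigcapT_measurable => k; case: (UP k).
exists (\bigcap_k U k); split=> //; last by move=> x Ax k _; case: (UP k) => _ + _; apply.
apply/eqP; rewrite eq_le measure_ge0 andbT; apply/lee_addgt0Pr => eps eps0.
rewrite add0e; set k := Num.bound eps^-1.
have [mUk _ PUk] := UP k.
apply: (@le_trans _ _ (P (U k))).
  by apply: le_measure; rewrite ?inE // => x; apply.
apply: le_trans PUk _; rewrite lee_fin invf_ple ?posrE //.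
have : eps^-1 < k%:R by apply: archi_boundP; rewrite invr_ge0 ltW.
by move=> /ltW /le_trans; apply; rewrite ler_nat.
Qed.

Section ProductNegligible.
Context d' d (T' : measurableType d') (T : measurableType d) (R : realType).
Variables (mu' : probability T' R) (mu : probability T R).

Lemma product_measure_cover (E' : set T') (E : set T) (e' e : R) :
  measurable E' -> measurable E -> (mu' E' <= e'%:E)%E -> (mu E <= e%:E)%E ->
  measurable (E' `*` setT `|` setT `*` E) /\
  ((mu' \x mu)%E (E' `*` setT `|` setT `*` E) <= (e' + e)%:E)%E.
Proof.
move=> mE' mE E'e Ee; have mA : measurable (E' `*` @setT T) by exact: measurableX.
have mB : measurable (@setT T' `*` E) by exact: measurableX.
have PA : (mu' \x mu)%E (E' `*` setT) = mu' E'.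
  by rewrite product_measure1E //; have /= -> := probability_setT mu; rewrite mule1.
have PB : (mu' \x mu)%E (setT `*` E) = mu E.
  by rewrite product_measure1E //; have /= -> := probability_setT mu'; rewrite mul1e.
split; first exact: measurableU.
apply: le_trans (measureU2 _ mA mB) _.
by rewrite EFinD; apply: leeD; [rewrite [leLHS]PA|rewrite [leLHS]PB].
Qed.

Lemma ae_product_fst (Q : T' -> Prop) : {ae mu', forall x, Q x} ->
  {ae (mu' \x mu)%E, forall w : T' * T, Q w.1}.
Proof.
move=> [N [mN N0 QN]]; exists (N `*` setT); split; first exact: measurableX.
  by rewrite product_measure1E // ; have /= -> := N0; rewrite mul0e.
by move=> [x y] /= /QN; split.
Qed.

Lemma ae_product_snd (Q : T -> Prop) : {ae mu, forall x, Q x} ->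
  {ae (mu' \x mu)%E, forall w : T' * T, Q w.2}.
Proof.
move=> [N [mN N0 QN]]; exists (setT `*` N); split; first exact: measurableX.
  by rewrite product_measure1E // ; have /= -> := N0; rewrite mule0.
by move=> [x y] /= /QN; split.
Qed.

End ProductNegligible.

(** Termwise, (1 - s') (1 - s) >= 1 - s' - s and m^(n-j) m^j = m^n; summing leaves n+1 minus twice
    (n+1)/4. *)
Lemma sum_product_lower (R : realFieldType) (z' z : nat -> nat) (d' d m : R)
    (s' s : nat -> R) n :
  0 < d' -> 0 < d -> 0 < m -> (forall j, 0 <= s' j) -> (forall j, 0 <= s j) ->
  (forall j, (j <= n)%N -> d' * (1 - s' j) * m ^+ j <= (z' j)%:R) ->
  (forall j, (j <= n)%N -> d * (1 - s j) * m ^+ j <= (z j)%:R) ->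
  \sum_(j <- iota 0 n.+1) s' j <= n.+1%:R / 4 ->
  \sum_(j <- iota 0 n.+1) s j <= n.+1%:R / 4 ->
  d' * d * m ^+ n * (n.+1%:R / 2) <= (\sum_(j <- iota 0 n.+1) z' (n - j) * z j)%:R.
Proof.
move=> d'0 d0 m0 s'0 s0 z's zs S' S.
have term j : (j <= n)%N ->
    d' * d * m ^+ n * (1 - s' (n - j)%N - s j) <= (z' (n - j)%N * z j)%:R.
  move=> jn; set S1 := s' (n - j)%N; set S2 := s j.
  have S10 : 0 <= S1 by exact: s'0.
  have S20 : 0 <= S2 by exact: s0.
  have mE : m ^+ n = m ^+ (n - j) * m ^+ j by rewrite -exprD subnK.
  have c0 : 0 <= d' * d * m ^+ n by rewrite !mulr_ge0 ?exprn_ge0 // ltW.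
  (* The lower bounds can be multiplied only when nonnegative; otherwise the claimed bound is itself
     at most 0. *)
  have [neg|pos] := leP (1 - S1 - S2) 0.
    by apply: (@le_trans _ _ 0) => //; rewrite mulr_ge0_le0.
  have P1 : 0 <= d' * (1 - S1) * m ^+ (n - j).
    by rewrite !mulr_ge0 ?exprn_ge0 //; lra.
  have P2 : 0 <= d * (1 - S2) * m ^+ j.
    by rewrite !mulr_ge0 ?exprn_ge0 //; lra.
  rewrite natrM; apply: le_trans (ler_pM P1 P2 (z's _ (leq_subr j n)) (zs _ jn)).
  have -> : d' * (1 - S1) * m ^+ (n - j) * (d * (1 - S2) * m ^+ j) =
      d' * d * (m ^+ (n - j) * m ^+ j) * ((1 - S1) * (1 - S2)) by lra.
  rewrite -mE; apply: ler_wpM2l => //.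
  have : 0 <= S1 * S2 by exact: mulr_ge0.
  lra.
rewrite natr_sum; apply: (@le_trans _ _
  (\sum_(j <- iota 0 n.+1) d' * d * m ^+ n * (1 - s' (n - j)%N - s j))); last first.
  by rewrite big_seq [leRHS]big_seq; apply: ler_sum => j; rewrite mem_iota => jn; apply: term.
rewrite -mulr_sumr; apply: ler_wpM2l; first by rewrite !mulr_ge0 ?exprn_ge0 // ltW.
have rev_s' : \sum_(j <- iota 0 n.+1) s' (n - j)%N = \sum_(j <- iota 0 n.+1) s' j.
  have : \sum_(0 <= j < n.+1) s' j = \sum_(0 <= j < n.+1) s' (0 + n.+1 - j.+1)%N.
    by rewrite big_nat_rev.
  rewrite /index_iota subn0 => ->.
  by apply: eq_bigr => j _; rewrite add0n subSS.
have -> : \sum_(j <- iota 0 n.+1) (1 - s' (n - j)%N - s j) =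
    n.+1%:R - \sum_(j <- iota 0 n.+1) s' j - \sum_(j <- iota 0 n.+1) s j.
  rewrite -rev_s' !sumrB; congr (_ - _ - _).
  by rewrite big_const_seq count_predT size_iota iter_addr_0.
lra.
Qed.

Section AmenableTetrahedra.
Variables (V' V : choiceType) (T' : graph V') (T : graph V).
Variables (h' : V' -> int) (h : V -> int).
Variables (par' : V' -> V') (ch' : V' -> seq V') (ed' : V' -> edge T').
Variables (par : V -> V) (ch : V -> seq V) (ed : V -> edge T).
Hypotheses (HT' : horotree h' par' ch' ed') (HT : horotree h par ch ed).
Variables (R : realType) (a' a : nat).
Hypothesis ch_size' : forall x, vset T' x -> size (ch' x) = a'.
Hypothesis ch_size : forall x, vset T x -> size (ch x) = a.

Definition tetrahedron_bound n x' x (w : config T' * config T) : R :=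
  (a' * size (desc ch' ed' w.1 n x') + a * size (desc ch ed w.2 n x))%:R /
  (tetrahedron_size ch' ed' ch ed w.1 w.2 x' x n)%:R.

Definition open_children (w : config T' * config T) :=
  (forall x, vset T' x -> exists2 y, y \in ch' x & w.1 (ed' y)) /\
  (forall x, vset T x -> exists2 y, y \in ch x & w.2 (ed y)).

Variables (o' : V') (o : V).
Hypotheses (To' : vset T' o') (To : vset T o) (ho' : h' o' = 0) (ho : h o = 0).

Let H (w : config T' * config T) := horo h' h (open_graph w.1) (open_graph w.2).
Let Gamma (w : config T' * config T) :=
  induced_subgraph (H w) (component (H w) (o', o)).

Let limit_ratio (xs' : nat -> V') (xs : nat -> V) w : open_children w ->
  (forall n, vset T' (xs' n)) -> (forall n, vset T (xs n)) ->
  (forall n, h' (xs' n) = - h (xs n) - n%:Z) ->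
  (forall n, tetrahedron ch' ed' ch ed w.1 w.2 (xs' n) (xs n) n (o', o)) ->
  (forall N, exists2 n, (N <= n)%N & tetrahedron_bound n (xs' n) (xs n) w <= N.+1%:R^-1) ->
  limn_einf (fun n : nat => ereal_inf
    [set iso_ratio R (Gamma w) F | F in
      [set F | [/\ subgraph F (Gamma w), connected_graph F,
                   (vset F #= `I_n)%card & vset F (o', o)]]]) = 0%E.
Proof.
move=> [op' op] Txs' Txs lvl troot small; apply: limn_einf_eq0.
  move=> n; apply: le_ereal_inf_tmp => _ [F _ <-].
  apply: mule_ge0; last by rewrite lee_fin invr_ge0.
  by rewrite /counting; case: ifP => // _; rewrite lee_fin.
move=> eps N0 eps0; have [n Nn rn] := small (N0 + Num.bound eps^-1)%N.
have [F [FP FI]] := tetrahedron_ratio HT' HT op' op (Txs' n) (Txs n) (lvl n)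
  ch_size' ch_size (troot n) R.
exists (tetrahedron_size ch' ed' ch ed w.1 w.2 (xs' n) (xs n) n).
  (* The liminf runs over numbers of vertices rather than over [n]. All [n.+1] layers are nonempty,
     so the tetrahedron has more than [n] vertices and the sizes are unbounded. *)
  apply: (@leq_trans n.+1); first by lia.
  rewrite /tetrahedron_size -[leqLHS](size_iota 0) -sum1_size.
  by apply: leq_sum => j _; rewrite muln_gt0 !(desc_nonempty HT) ?(desc_nonempty HT').
apply: (@le_trans _ _ (iso_ratio R (Gamma w) F)).
  by apply: ereal_inf_lbound; exists F.
apply: le_trans FI _; rewrite lee_fin; apply: le_trans rn _.
rewrite invf_ple ?posrE //; apply/ltW.
apply: (@lt_le_trans _ _ (Num.bound eps^-1)%:R).
  by apply: archi_boundP; rewrite invr_ge0 ltW.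
by rewrite ler_nat; lia.
Qed.

Lemma strongly_amenable_of_small_ratio w : open_children w ->
  (forall N, exists2 n, (N <= n)%N & tetrahedron_bound n (iter n par' o') o w <= N.+1%:R^-1) ->
  (forall N, exists2 n, (N <= n)%N & tetrahedron_bound n o' (iter n par o) w <= N.+1%:R^-1) ->
  strongly_amenable R (Gamma w) (o', o).
Proof.
move=> opw small' small; rewrite /strongly_amenable /anchored_constant.
case: asboolP => // infG.
have [spine'|] := pselect (forall i, w.1 (ed' (iter i par' o'))).
  apply: limit_ratio small' => // n; first exact (vset_iter_par HT' n To').
    by rewrite (level_iter_par HT') // ho' ho; lia.
  exists n, 0%N; split; [exact: addn0| |exact: mem_head].
  by apply/(mem_desc HT'); [exact: (vset_iter_par HT')|split].
move=> /existsNP closed'.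
have [spine|] := pselect (forall i, w.2 (ed (iter i par o))).
  apply: limit_ratio small => // n; first exact: (vset_iter_par HT).
    by rewrite (level_iter_par HT) // ho' ho; lia.
  exists 0%N, n; split; [exact: add0n|exact: mem_head|].
  by apply/(mem_desc HT); [exact: (vset_iter_par HT)|split].
move=> /existsNP closed; exfalso; apply: infG.
have ex' : exists i, ~~ w.1 (ed' (iter i par' o')) by case: closed' => i /negP; exists i.
have ex : exists i, ~~ w.2 (ed (iter i par o)) by case: closed => i /negP; exists i.
(* The apexes are placed just below the first closed edge of each ray: the root is then a descendant
   of both by open edges, and the tetrahedron of height [i + j] has no exit. *)
have [i ci mini] := ex_minnP ex'; have [j cj minj] := ex_minnP ex.
have fin : finite_set (component (H w) (o', o)).
  apply: (closed_tetrahedron_component HT' HT (x' := iter i par' o')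
    (x := iter j par o) (n := i + j)) ci cj.
  - exact: (vset_iter_par HT').
  - exact: (vset_iter_par HT).
  - by rewrite (level_iter_par HT') // (level_iter_par HT) // ho' ho; lia.
  - exists i, j; split=> //.
      apply/(mem_desc HT'); first exact: (vset_iter_par HT').
      split=> // l li; apply: contraLR li => /mini; rewrite -leqNgt; exact.
    apply/(mem_desc HT); first exact: (vset_iter_par HT).
    by split=> // l li; apply: contraLR li => /minj; rewrite -leqNgt; exact.
by apply: sub_finite_set fin => k [].
Qed.

End AmenableTetrahedra.

Section RandomTetrahedra.
Variables (V' V : choiceType) (T' : graph V') (T : graph V).
Variables (h' : V' -> int) (h : V -> int).
Variables (par' : V' -> V') (ch' : V' -> seq V') (ed' : V' -> edge T').
Variables (par : V -> V) (ch : V -> seq V) (ed : V -> edge T).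
Hypotheses (HT' : horotree h' par' ch' ed') (HT : horotree h par ch ed).
Variables (R : realType) (mu' : probability (config T') R) (mu : probability (config T) R).
Variables (mk' : pred (edge T')) (mk : pred (edge T)) (p' p : R).
Hypotheses (p'01 : 0 <= p' <= 1) (p01 : 0 <= p <= 1).
Hypotheses (perc' : percolation_measure mk' p' mu') (perc : percolation_measure mk p mu).
Variables (a' a0' a a0 : nat).
Hypotheses (a01' : (1 <= a0' <= a')%N) (a01 : (1 <= a0 <= a)%N).
Hypothesis ch_size' : forall x, vset T' x -> size (ch' x) = a' /\
  count (fun y => ~~ mk' (ed' y)) (ch' x) = a0'.
Hypothesis ch_size : forall x, vset T x -> size (ch x) = a /\
  count (fun y => ~~ mk (ed y)) (ch x) = a0.
Hypothesis same_mean : mean_offspring p' a' a0' = mean_offspring p a a0.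

Let ratio := tetrahedron_bound ch' ed' ch ed R a' a.
Let opens := open_children ch' ed' ch ed.

Lemma ae_open_children : {ae (mu' \x mu)%E, forall w, opens w}.
Proof.
have := ae_product_fst mu (ae_open_child perc' a01' ch_size').
apply: filterS2 (ae_product_snd mu' (ae_open_child perc a01 ch_size)).
by move=> w; split.
Qed.

(** The apexes are deterministic, so the estimates for the two trees apply without reference to the
    open rays. Each [bad N] lies in the exceptional event of a single large [n], hence has
    arbitrarily small outer measure. *)
Lemma ae_small_ratio (xs' : nat -> V') (xs : nat -> V) :
  (forall n, vset T' (xs' n)) -> (forall n, vset T (xs n)) ->
  {ae (mu' \x mu)%E, forall w, opens w -> forall N,
    exists2 n, (N <= n)%N & ratio n (xs' n) (xs n) w <= N.+1%:R^-1}.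
Proof.
move=> Txs' Txs.
pose bad N := [set w | opens w /\
  forall n, (N <= n)%N -> N.+1%:R^-1 < ratio n (xs' n) (xs n) w].
suff badN N : (mu' \x mu)%E.-negligible (bad N).
  apply: negligibleS (negligible_bigcup badN) => w nw; apply: contrapT => nbad.
  apply: nw => opw N; apply: contrapT => nex; apply: nbad; exists N => //; split=> // n Nn.
  by rewrite ltNge; apply/negP => rn; apply: nex; exists n.
apply: negligible_small_cover => eps eps0; have eps20 : 0 < eps / 2 by lra.
have [d' [K' [d'0 K'0 [n0' typ']]]] :=
  percolation_typical HT' p'01 perc' a01' ch_size' eps20.
have [d [K [d0 K0 [n0 typ]]]] := percolation_typical HT p01 perc a01 ch_size eps20.
have m1 := mean_offspring_ge1 p01 a01.
rewrite same_mean in typ'; move: (mean_offspring p a a0) m1 typ' typ => m m1 typ' typ.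
have m0 : 0 < m by lra.
set B := a'%:R * K' + a%:R * K.
have B0 : 0 <= B by rewrite addr_ge0 // mulr_ge0 // ltW.
(* Outside the exceptional events the ratio is at most B m^n / (d' d m^n (n+1)/2) = C / (n+1). *)
set C := B * 2 / (d' * d).
have dd0 : 0 < d' * d by rewrite mulr_gt0.
have C0 : 0 <= C by rewrite divr_ge0 ?mulr_ge0 // ltW.
have [n [nN n0n' n0n bn]] : exists n,
    [/\ (N <= n)%N, (n0' <= n)%N, (n0 <= n)%N & (Num.bound (C * N.+1%:R) <= n)%N].
  exists (maxn (maxn N n0') (maxn n0 (Num.bound (C * N.+1%:R)))).
  by rewrite !leq_max !leqnn !orbT.
have Cn : C / n.+1%:R <= N.+1%:R^-1.
  rewrite ler_pdivrMr // ler_pdivlMl // mulrC.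
  apply: (@le_trans _ _ (Num.bound (C * N.+1%:R))%:R).
    by apply/ltW/archi_boundP; rewrite mulr_ge0.
  by rewrite ler_nat leqW.
have [E' [mE' muE' E'P]] := typ' n (xs' n) n0n' (Txs' n).
have [E [mE muE EP]] := typ n (xs n) n0n (Txs n).
have [mU muU] := product_measure_cover mE' mE muE' muE.
exists (E' `*` setT `|` setT `*` E); split=> //; last first.
  by apply: le_trans muU _; rewrite lee_fin; lra.
move=> w [[op' op] /(_ n nN) badw]; apply: contrapT => nU.
have nE' : ~ E' w.1 by move=> E'w; apply: nU; left.
have nE : ~ E w.2 by move=> Ew; apply: nU; right.
have [Zn' [s' [s'0 Zs' S']]] := E'P _ nE' (fun j => desc_nonempty HT' op' j (Txs' n)).
have [Zn [s [s0 Zs S]]] := EP _ nE (fun j => desc_nonempty HT op j (Txs n)).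
have lower := sum_product_lower d'0 d0 m0 s'0 s0 Zs' Zs S' S.
move: badw; rewrite ltNge => /negP; apply; apply: le_trans Cn.
have mn0 : 0 < m ^+ n by exact: exprn_gt0.
rewrite /ratio /tetrahedron_bound ler_pdivrMr; last first.
  by apply: lt_le_trans lower; rewrite !mulr_gt0 // divr_gt0.
apply: (@le_trans _ _ (B * m ^+ n)).
  rewrite natrD !natrM /B mulrDl -!mulrA.
  by apply: lerD; apply: ler_wpM2l.
have Cn0 : 0 <= C / n.+1%:R by rewrite divr_ge0.
apply: le_trans (ler_wpM2l Cn0 lower).
rewrite le_eqVlt; apply/orP; left; apply/eqP; rewrite /C.
have dd1 := @mulVf _ (d' * d) (lt0r_neq0 dd0).
have n1 : n.+1%:R^-1 * n.+1%:R = 1 :> R by rewrite mulVf.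
move: (m ^+ n) (d' * d) (d' * d)^-1 (n.+1%:R : R) (n.+1%:R^-1 : R) dd1 n1.
move=> x y yi z zi yy zz.
have -> : B * 2 * yi * zi * (y * x * (z / 2)) = B * x * (yi * y) * (zi * z) by lra.
by rewrite yy zz !mulr1.
Qed.

End RandomTetrahedra.

Theorem theorem2p1 (R : realType)
    (a' a a0' a0 : nat) (p' p : R)
    (V' V : choiceType) (T' : graph V') (T : graph V) (o' : V') (o : V)
    (g' : set (nat -> V')) (g : set (nat -> V))
    (num' : edge T' -> nat) (num : edge T -> nat)
    (mu' : probability (config T') R) (mu : probability (config T) R) :
  (1 <= a')%N -> (1 <= a)%N ->
  (1 <= a0' <= a')%N -> (1 <= a0 <= a)%N ->
  0 <= p <= 1 -> p' = p ->
  homogeneous_tree a'.+1 T' -> homogeneous_tree a.+1 T ->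
  vset T' o' -> vset T o ->
  is_end T' g' -> is_end T g ->
  let h' := busemann T' g' o' in
  let h := busemann T g o in
  child_numbering h' a' num' -> child_numbering h a num ->
  percolation_measure (marked num' a0') p' mu' ->
  percolation_measure (marked num a0) p mu ->
  a0'%:R + p' * (a'%:R - a0'%:R) = a0%:R + p * (a%:R - a0%:R) ->
  {ae (mu' \x mu)%E, forall w : config T' * config T,
     let H := horo h' h (open_graph w.1) (open_graph w.2) in
     strongly_amenable R (induced_subgraph H (component H (o', o))) (o', o)}.
Proof.
move=> a'1 a1 a01' a01 p01 p'p Thom' Thom To' To Tend' Tend h' h num'P numP perc' perc.
move=> same_mean; have p'01 : 0 <= p' <= 1 by rewrite p'p.
have [Ttree' _] := Thom'; have [Ttree _] := Thom.
have [par' [ch' [ed' [HT' ch_size']]]] :=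
  exists_horotree Ttree' Tend' To' num'P (andP a01').2.
have [par [ch [ed [HT ch_size]]]] := exists_horotree Ttree Tend To numP (andP a01).2.
have small := ae_small_ratio HT' HT p'01 p01 perc' perc a01' a01 ch_size' ch_size same_mean.
(* Both candidate apex sequences are treated before [w] is fixed; which of them contains the root is
   decided afterwards, configuration by configuration. *)
have small1 := small (fun n => iter n par' o') (fun=> o)
  (fun n => vset_iter_par HT' n To') (fun=> To).
have small2 := small (fun=> o') (fun n => iter n par o)
  (fun=> To') (fun n => vset_iter_par HT n To).
have opens := ae_open_children perc' perc a01' a01 ch_size' ch_size.
apply: filterS3 opens small1 small2 => w opw small1 small2.
exact (strongly_amenable_of_small_ratio HT' HT
  (fun x Tx => (ch_size' x Tx).1) (fun x Tx => (ch_size x Tx).1) To' To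
  (busemann_root Ttree' Tend' To') (busemann_root Ttree Tend To) opw
  (small1 opw) (small2 opw)).
Qed.
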